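(* Let $D$ be a non-commutative division ring with center $F$ and let $M$ be a locally nilpotent maximal subgroup of $D^*$. If the derived subgroup $M'$ of $M$ is algebraic over $F$, then there is a maximal subfield $K$ of $D$ with $M=K^*=K\setminus\{0\}$.
   Context: $D^*$ is the multiplicative group of $D$; a maximal subgroup of $D^*$ is a proper subgroup not contained in any other proper subgroup. A group is locally nilpotent if every finitely generated subgroup is nilpotent. A subset of $D$ is algebraic over $F$ if each of its elements is algebraic over $F$. A maximal subfield of $D$ is a subfield not properly contained in any other subfield of $D$. *)

(* Defs.v *)
From mathcomp Require Import all_boot all_algebra.
Set Implicit Arguments. Unset Strict Implicit. Unset Printing Implicit Defensive.
Import GRing.Theory.
Local Open Scope ring_scope.

Section DivRingGroups.
Variable D : unitRingType.

Definition subset_of (A B : D -> Prop) := forall x, A x -> B x.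

Definition is_division_ring := forall x : D, x != 0 -> x \is a GRing.unit.

Definition is_subgroup (H : D -> Prop) :=
  [/\ H 1, (forall x, H x -> x \is a GRing.unit),
      (forall x y, H x -> H y -> H (x * y)) & (forall x, H x -> H x^-1)].

Definition maximal_subgroup (M : D -> Prop) :=
  [/\ is_subgroup M,
      (exists x, x \is a GRing.unit /\ ~ M x) &
      (forall H, is_subgroup H -> subset_of M H ->
         subset_of H M \/ (forall x, x \is a GRing.unit -> H x))].

Definition gen (S : D -> Prop) : D -> Prop :=
  fun x => forall H, is_subgroup H -> subset_of S H -> H x.

Definition gcomm (x y : D) := x^-1 * y^-1 * x * y.

Definition comm_sub (A B : D -> Prop) : D -> Prop :=
  gen (fun z => exists x y, [/\ A x, B y & z = gcomm x y]).

Fixpoint lower_central (H : D -> Prop) (n : nat) : D -> Prop :=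
  match n with
  | 0 => H
  | n'.+1 => comm_sub (lower_central H n') H
  end.

Definition nilpotent_subgroup (H : D -> Prop) :=
  exists n, forall x, lower_central H n x <-> x = 1.

Definition locally_nilpotent (M : D -> Prop) :=
  forall s : seq D, (forall x, x \in s -> M x) ->
    nilpotent_subgroup (gen (fun x => x \in s)).

Definition derived_subgroup (M : D -> Prop) := comm_sub M M.

Definition in_center (x : D) := forall y : D, x * y = y * x.

Definition algebraic_over_center (x : D) :=
  exists p : {poly D}, [/\ p != 0, (forall i, in_center p`_i) & root p x].

Definition set_algebraic_over_center (A : D -> Prop) :=
  forall x, A x -> algebraic_over_center x.

Definition is_subfield (K : D -> Prop) :=
  K 0 /\ K 1 /\
      (forall x y, K x -> K y -> K (x - y)) /\
      (forall x y, K x -> K y -> K (x * y)) /\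
      (forall x, K x -> x != 0 -> K x^-1) /\
      (forall x y, K x -> K y -> x * y = y * x).

Definition maximal_subfield (K : D -> Prop) :=
  is_subfield K /\ (forall L, is_subfield L -> subset_of K L -> subset_of L K).

End DivRingGroups.

(* Main.v *)
(** If some [h] in [M], not in [F], centralizes [M], then [M = C_D(h)^*], which is
commutative: for [u] in the second center of the nilpotent group generated by [a],
[b], [1 + a] and [1 + b], centrality of both [[u, a]] and [[u, 1 + a]] forces [u] to
commute with [a]. Assume from now on that there is no such [h].

Call [h] in [M] semicentral if it is noncentral but all [[h, m]] are central.
Then [M] normalizes the division ring [C_D(h)], so by maximality and
Cartan-Brauer-Hua [C_D(h)^*] lies in [M] and [C_D(h)] is a field. Algebraicity of
[M'] makes [[h, x] = c] a root of unity, of prime order [p] without loss of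
generality, and Engel's condition on [t + h], for [t] in [C_D(h)] fixed by [x],
makes [zeta_t = [t + h, x]] a root of unity of [p]-power order with
[h (zeta_t - c) = t (1 - zeta_t)]. In characteristic 0, comparing [t = 1] with
[t = p + 1] turns [p + 1] into a unit of a ring of algebraic integers; in positive
characteristic, [t = 1] and [t = x^p] show that [h] and [x] generate a finite ring,
contradicting Wedderburn. So there is no semicentral element.

It follows, by computing in the second and third centers of two-generated
subgroups, that elements of [M] with a central power are central. If [h] is in
[M'], a conjugation relation [h^(g^r) = h s] with [s] centralizing [g] and [h]
yields infinitely many roots [h s^i] of the minimal polynomial of [h] unless [s]
is torsion; by induction on the upper central series all [[h, g]] are torsion,
hence central. So [M'], and then [M], is central: a contradiction. *)
Require Import Defs.
From Stdlib Require Import Classical.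
From HB Require Import structures.
From mathcomp Require Import all_boot all_algebra all_field.
Set Implicit Arguments.
Unset Strict Implicit.
Unset Printing Implicit Defensive.
Import GRing.Theory.
Local Open Scope ring_scope.

(** * Commutators and upper central series *)

Section UnitGroups.
Variable D : unitRingType.
Implicit Types (x y g u : D) (G H : D -> Prop).

Lemma commrX_eq x y n : x * y = y * x -> x * y ^+ n = y ^+ n * x.
Proof. by move=> xy; apply: commrX. Qed.

Lemma commrV_eq x y : x * y = y * x -> x * y^-1 = y^-1 * x.
Proof. by move=> xy; apply: commrV. Qed.

Lemma mulr_gcomm x g :
  x \is a GRing.unit -> g \is a GRing.unit -> x * g = g * x * gcomm x g.
Proof. by move=> Ux Ug; rewrite /gcomm !mulrA (mulrK Ux) divrr // mul1r. Qed.

Lemma gcomm_eq x g u : x \is a GRing.unit -> g \is a GRing.unit ->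
  x * g = g * x * u -> gcomm x g = u.
Proof.
move=> Ux Ug E; rewrite /gcomm -mulrA E !mulrA.
by rewrite -[X in X * u]mulrA -[X in X * u]mulrA mulKr // mulVr // mul1r.
Qed.

Lemma gcomm1P x g : x \is a GRing.unit -> g \is a GRing.unit ->
  gcomm x g = 1 <-> x * g = g * x.
Proof.
move=> Ux Ug; split=> [E | E]; first by rewrite mulr_gcomm // E mulr1.
by apply: gcomm_eq; rewrite // mulr1.
Qed.

Lemma subgroup_unit G x : is_subgroup G -> G x -> x \is a GRing.unit.
Proof. by case=> _ U _ _; apply: U. Qed.

Lemma subgroup1 G : is_subgroup G -> G 1.
Proof. by case. Qed.

Lemma subgroupM G x y : is_subgroup G -> G x -> G y -> G (x * y).
Proof. by case=> _ _ clM _; apply: clM. Qed.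

Lemma subgroupV G x : is_subgroup G -> G x -> G x^-1.
Proof. by case=> _ _ _; apply. Qed.

Lemma subgroupX G x n : is_subgroup G -> G x -> G (x ^+ n).
Proof.
move=> sG Gx; elim: n => [|n IH]; first exact: subgroup1.
by rewrite exprS; apply: subgroupM.
Qed.

Lemma subgroup_gcomm G x y : is_subgroup G -> G x -> G y -> G (gcomm x y).
Proof.
by move=> sG Gx Gy; rewrite /gcomm; do 3?[apply: subgroupM => //]; apply: subgroupV.
Qed.

Lemma gen_sub (S : D -> Prop) x : S x -> gen S x.
Proof. by move=> Sx H _; apply. Qed.

Lemma gen_subgroup (S G : D -> Prop) : is_subgroup G -> subset_of S G ->
  is_subgroup (gen S).
Proof.
move=> sG SG; split=> [H sH _|x gx|x y gx gy H sH SH|x gx H sH SH].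
- exact: subgroup1.
- exact: subgroup_unit sG (gx _ sG SG).
- by apply: subgroupM (gx _ sH SH) (gy _ sH SH).
- by apply: subgroupV (gx _ sH SH).
Qed.

Lemma centralizer_subgroup x :
  is_subgroup (fun g => g \is a GRing.unit /\ x * g = g * x).
Proof.
split=> [|g []|g h [Ug xg] [Uh xh]|g [Ug xg]] //.
- by rewrite unitr1 mulr1 mul1r.
- by split; [rewrite unitrMr | rewrite mulrA xg -mulrA xh mulrA].
- by split; [rewrite unitrV | apply: commrV_eq].
Qed.

Lemma gen_comm (S : D -> Prop) x : (forall g, S g -> g \is a GRing.unit) ->
  (forall g, S g -> x * g = g * x) -> forall g, gen S g -> x * g = g * x.
Proof.
move=> SU xS g /(_ _ (centralizer_subgroup x)); case=> // h Sh.
by split; [apply: SU | apply: xS].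
Qed.

(** The upper central series, phrased through commutators so that no quotient group is needed. *)
Fixpoint ucs (G : D -> Prop) (n : nat) : D -> Prop :=
  match n with
  | 0 => fun x => x = 1
  | n'.+1 => fun x => G x /\ forall g, G g -> ucs G n' (gcomm x g)
  end.

Lemma ucs_sub G n x : is_subgroup G -> ucs G n x -> G x.
Proof. by case: n => [|n] sG /=; [move->; apply: subgroup1 | case]. Qed.

Lemma ucsS G n x : is_subgroup G -> ucs G n x -> ucs G n.+1 x.
Proof.
move=> sG; elim: n x => [|n IH] x /=; last first.
  by case=> Gx Zx; split=> // g Gg; apply: IH; apply: Zx.
move=> ->; split=> [|g Gg]; first exact: subgroup1.
have Ug := subgroup_unit sG Gg.
by apply/gcomm1P; rewrite // ?unitr1 // mulr1 mul1r.
Qed.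

Lemma ucs1P G x : is_subgroup G ->
  ucs G 1 x <-> G x /\ forall g, G g -> x * g = g * x.
Proof.
move=> sG; split=> -[Gx E]; split=> // g Gg; have /= := E g Gg;
  by case: (gcomm1P (subgroup_unit sG Gx) (subgroup_unit sG Gg)); auto.
Qed.

(** Either every commutator of [x] lies in level [k], or one of them escapes it and belongs to the
    next lower term; the descent stops just above level [k]. *)
Lemma ucs_witness G n k x : is_subgroup G -> ucs G n x -> ~ ucs G k x ->
  exists y, ucs G k.+1 y /\ ~ ucs G k y.
Proof.
move=> sG; elim: n x => [|n IH] x /=.
  by move=> -> []; elim: k => [|k IHk] //; apply: ucsS.
case=> Gx Zx nZx; case: (classic (forall g, G g -> ucs G k (gcomm x g))) => [Zk|].
  by exists x.
move/not_all_ex_not=> [g ng]; have [Gg nZ] := imply_to_and _ _ ng.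
exact: (IH _ (Zx g Gg) nZ).
Qed.

(** By induction on [k], term [n - k] of the lower central series lies in term [k] of the upper
    one. *)
Lemma nilpotent_ucs G : is_subgroup G -> nilpotent_subgroup G ->
  exists n, forall x, G x -> ucs G n x.
Proof.
move=> sG [n Gn]; exists n; suff: forall k x, (k <= n)%N ->
    lower_central G (n - k) x -> G x -> ucs G k x.
  by move=> H x Gx; apply: (H n) => //; rewrite subnn.
elim=> [|k IH] x le_kn; first by rewrite subn0 => /Gn ->.
move=> Lx Gx; split=> // g Gg; apply: IH; first exact: ltnW.
  have ->: (n - k = (n - k.+1).+1)%N by rewrite -subSn.
  by apply: gen_sub; exists x, g.
exact: subgroup_gcomm.
Qed.

(** Each commutation with [x] lowers the level in the upper central series by one. *)
Lemma engel G x y : is_subgroup G -> nilpotent_subgroup G -> G x -> G y ->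
  exists n, iter n (fun z => gcomm z x) y = 1.
Proof.
move=> sG /(nilpotent_ucs sG)[n Gn] Gx Gy; exists n.
elim: n y {Gn Gy}(Gn y Gy) => [|n IH] y /=; first by [].
by case=> _ /(_ x Gx)/IH; rewrite -(iterSr n (fun z => gcomm z x) y).
Qed.

Lemma expr_mulr_gcomm u g c n : u * g = g * u * c -> u * c = c * u ->
  u ^+ n * g = g * u ^+ n * c ^+ n.
Proof.
move=> ug uc; elim: n => [|n IH]; first by rewrite !expr0 !mulr1 mul1r.
rewrite [u ^+ n.+1]exprSr [c ^+ n.+1]exprSr -mulrA ug !mulrA IH.
by rewrite -(mulrA _ (c ^+ n) u) -(commrX_eq n uc) !mulrA.
Qed.

(** Each passage of [y] across a [g] leaves a [u], and moving the earlier copies of [u] across the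
    later [g] leaves 0 + 1 + ... + (n - 1) copies of [c]. Taking [c = 1] gives the class two
    formula. *)
Lemma mulr_expr_gcomm y g u c n : y * g = g * y * u -> u * g = g * u * c ->
  c * g = g * c -> c * u = u * c ->
  y * g ^+ n = g ^+ n * y * u ^+ n * c ^+ 'C(n, 2).
Proof.
move=> yg ug cg cu.
have cgX k : c ^+ k * g = g * c ^+ k by rewrite -(commrX_eq k (esym cg)).
elim: n => [|n IH]; first by rewrite !expr0 !mulr1 mul1r.
rewrite [g ^+ n.+1]exprSr [u ^+ n.+1]exprS binS bin1 addnC exprD !mulrA IH.
rewrite -(mulrA _ (c ^+ _) g) cgX !mulrA -(mulrA _ (u ^+ n) g).
rewrite (expr_mulr_gcomm n ug (esym cu)) !mulrA.
rewrite -(mulrA _ y g) yg !mulrA.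
by rewrite -(mulrA _ (c ^+ n)) -exprD addnC exprD !mulrA.
Qed.

End UnitGroups.

(** * Division rings *)

Section DivisionRing.
Variable D : unitRingType.
Hypothesis divD : is_division_ring D.
Implicit Types (x y g u d : D).

Lemma div_unitE x : (x \is a GRing.unit) = (x != 0).
Proof.
apply/idP/idP; last exact: divD.
by apply: contraTneq => ->; rewrite unitr0.
Qed.

Lemma div_mulf_eq0 x y : x * y = 0 -> x = 0 \/ y = 0.
Proof.
have [->|nx] := eqVneq x 0; first by left.
by move=> xy; right; apply: (mulrI (divD nx)); rewrite mulr0.
Qed.

Lemma sqr_eq_comm x y : x * y = y * x -> x ^+ 2 = y ^+ 2 -> x = y \/ x = - y.
Proof.
move=> xy E; have: (x - y) * (x + y) = 0.
  by rewrite mulrDr !mulrBl xy !expr2 in E *; rewrite E addrA subrK subrr.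
case/div_mulf_eq0 => [/subr0_eq|/addr0_eq <-]; first by left.
by right; rewrite opprK.
Qed.

Lemma sqr_eq1_pm x : x ^+ 2 = 1 -> x = 1 \/ x = -1.
Proof. by move=> E; apply: sqr_eq_comm; rewrite ?mul1r ?mulr1 // expr1n. Qed.

(** Over a noncommutative ring, the bound on the number of roots requires them to commute and to
    have invertible differences. *)
Lemma uniq_roots_comm (s : seq D) : {in s &, forall x y, x * y = y * x} ->
  uniq s -> uniq_roots s.
Proof.
elim: s => //= x s IH cs /andP[xs us]; rewrite IH // ?andbT; last first.
  by move=> y z ys zs; apply: cs; rewrite inE ?ys ?zs orbT.
apply/allP=> y ys; rewrite /diff_roots cs ?inE ?eqxx ?ys ?orbT //=.
by rewrite div_unitE subr_eq0; apply: contraNneq xs => <-.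
Qed.

Lemma comm_roots_repeat (p : {poly D}) (r : nat -> D) : p != 0 ->
  (forall i, root p (r i)) -> (forall i j, r i * r j = r j * r i) ->
  exists i j, (i < j)%N /\ r i = r j.
Proof.
move=> nz_p rp rC; apply: NNPP => nE.
have r_inj : injective r.
  move=> i j rij; apply/eqP/negPn/negP; rewrite neq_ltn.
  by case/orP=> lt; apply: nE; [exists i, j | exists j, i].
have := @max_ring_poly_roots _ p [seq r i | i <- iota 0 (size p)] nz_p.
rewrite size_map size_iota ltnn => H; suff: false by []; apply: H.
  by apply/allP=> _ /mapP[i _ ->].
apply: uniq_roots_comm; last by rewrite map_inj_uniq ?iota_uniq.
by move=> _ _ /mapP[i _ ->] /mapP[j _ ->].
Qed.

Lemma root_conj (p : {poly D}) u v g : (forall i, in_center p`_i) ->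
  g \is a GRing.unit -> u * g = g * v -> root p u -> root p v.
Proof.
move=> Zp Ug ug /rootP; rewrite horner_coef => pu; apply/rootP.
apply: (mulrI Ug); rewrite mulr0 horner_coef mulr_sumr.
transitivity ((\sum_(i < size p) p`_i * u ^+ i) * g); last by rewrite pu mul0r.
rewrite mulr_suml; apply: eq_bigr => i _.
rewrite mulrA -Zp -mulrA -[in RHS]mulrA; congr (_ * _).
elim: (nat_of_ord i) => [|k IH]; first by rewrite mulr1 mul1r.
by rewrite exprSr mulrA IH exprSr -!mulrA ug.
Qed.

(** The [v i] are conjugates of [u] by powers of [g], hence roots of one polynomial over the center;
    two of them coincide, and the quotient of the two powers commutes with [u]. *)
Lemma algebraic_conj_comm u g (v : nat -> D) : algebraic_over_center u ->
  g \is a GRing.unit -> (forall i, u * g ^+ i = g ^+ i * v i) ->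
  (forall i j, v i * v j = v j * v i) ->
  exists2 n, (0 < n)%N & u * g ^+ n = g ^+ n * u.
Proof.
move=> [p [nz_p Zp pu]] Ug E vC.
have [i|i [j [lt_ij vij]]] := comm_roots_repeat nz_p (r := v) _ vC.
  by apply: root_conj (E i) pu => //; rewrite unitrX.
exists (j - i)%N; first by rewrite subn_gt0.
have UX k : g ^+ k \is a GRing.unit by rewrite unitrX.
apply: (mulIr (UX i)); rewrite -mulrA -exprD subnK ?(ltnW lt_ij) // E -vij.
by rewrite -[in RHS]mulrA E mulrA -exprD subnK // ltnW.
Qed.

Lemma prime_primitive_root p d : prime p -> d ^+ p = 1 -> d != 1 ->
  p.-primitive_root d.
Proof.
move=> p_pr dp d1; have [m prim_d m_p] := prim_order_exists (prime_gt0 p_pr) dp.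
have /primeP[_ /(_ m m_p)/orP[/eqP m1|/eqP <-//]] := p_pr.
by move: (prim_expr_order prim_d); rewrite m1 expr1 => /eqP; rewrite (negPf d1).
Qed.

(** Otherwise [g] and the [p] powers of [d] would be [p + 1] commuting roots of [X^p - 1]. *)
Lemma prime_order_comm_power p d g : prime p -> d ^+ p = 1 -> d != 1 ->
  g ^+ p = 1 -> d * g = g * d -> exists i, g = d ^+ i.
Proof.
move=> p_pr dp d1 gp dg; apply: NNPP => nE.
have p_gt0 := prime_gt0 p_pr.
have prim_d := prime_primitive_root p_pr dp d1.
have nz : 'X^p - 1 != 0 :> {poly D} by rewrite -size_poly_eq0 size_XnsubC.
have := @max_ring_poly_roots _ _ (g :: [seq d ^+ i | i <- iota 0 p]) nz.
rewrite size_XnsubC //= size_map size_iota ltnn => H; suff: false by []; apply: H.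
  rewrite /root hornerD hornerN hornerXn hornerC gp subrr eqxx; apply/allP=> _ /mapP[i _ ->].
  by rewrite /root hornerD hornerN hornerXn hornerC -exprM mulnC exprM dp expr1n subrr.
apply: (@uniq_roots_comm (g :: _)).
  move=> x y; rewrite !inE => /orP[/eqP->|/mapP[i _ ->]] /orP[/eqP->|/mapP[j _ ->]] //.
  - by rewrite commrX_eq.
  - by rewrite -commrX_eq.
  - by rewrite -!exprD addnC.
rewrite /= map_inj_in_uniq ?iota_uniq ?andbT.
  by apply/mapP=> -[i _ E]; apply: nE; exists i.
move=> i j; rewrite !mem_iota /= add0n => ip jp /eqP.
by rewrite (eq_prim_root_expr prim_d) !modn_small // => /eqP.
Qed.

End DivisionRing.

(** * Finite and finitely generated subrings *)

(** Packages a finite list closed under the ring operations, so that it can carry a finite ring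
    structure and Wedderburn's theorem applies. *)
Record finSubring (D : unitRingType) := FinSubring {
  fsub_seq : seq D;
  fsub_closed : subring_closed (fun x => x \in fsub_seq) }.

Section FinSubring.
Variables (D : unitRingType) (F : finSubring D).

Definition fsub_pred : {pred D} := fun x => x \in fsub_seq F.
HB.instance Definition _ := GRing.isSubringClosed.Build D fsub_pred (fsub_closed F).

Record fsub_type := FsubType { fsub_val : D; _ : fsub_val \in fsub_pred }.
HB.instance Definition _ := [isSub for fsub_val].
HB.instance Definition _ := [Choice of fsub_type by <:].
HB.instance Definition _ := [SubChoice_isSubNzRing of fsub_type by <:].

Definition fsub_index (x : fsub_type) : seq_sub (fsub_seq F) := SeqSub (valP x).
Definition fsub_of_index (y : seq_sub (fsub_seq F)) : fsub_type := FsubType (ssvalP y).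
Lemma fsub_indexK : cancel fsub_index fsub_of_index.
Proof. by move=> x; apply: val_inj. Qed.
HB.instance Definition _ := Countable.copy fsub_type (can_type fsub_indexK).
HB.instance Definition _ : isFinite fsub_type := CanIsFinite fsub_indexK.
HB.instance Definition _ := FinRing.isNzRing.Build fsub_type.

Hypothesis divD : is_division_ring D.

Lemma fin_subring_commutative :
  {in fsub_seq F &, forall x y, x * y = y * x}.
Proof.
have dom : forall x y : fsub_type, x * y = 0 -> (x == 0) || (y == 0).
  move=> x y /(congr1 val); rewrite rmorphM rmorph0 => /(div_mulf_eq0 divD).
  by case=> E; apply/orP; [left | right]; apply/eqP/val_inj.
move=> x y xF yF; have /(congr1 val) := finDomain_mulrC dom (FsubType xF) (FsubType yF).
by rewrite !rmorphM.
Qed.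

End FinSubring.

Section Zspan.
Variable D : unitRingType.
Hypothesis divD : is_division_ring D.
Variables (N : nat) (v : 'I_N -> D).
Hypothesis v1 : exists k, v k = 1.
Hypothesis vM : forall i j, exists k, v i * v j = v k.

(** As the [v i] include 1 and are closed under products, this additive group is a subring. *)
Definition zspan (d : D) := exists f : 'I_N -> int, d = \sum_i v i *~ f i.

Lemma zspan_sum (I : Type) (r : seq I) (P : pred I) (F : I -> D) :
  (forall i, P i -> zspan (F i)) -> zspan (\sum_(i <- r | P i) F i).
Proof.
move=> PF; elim/big_ind: _ => //.
  by exists (fun _ => 0); rewrite big1 // => i _; rewrite mulr0z.
move=> _ _ [f ->] [g ->]; exists (fun i => f i + g i).
by rewrite -big_split; apply: eq_bigr => i _; rewrite mulrzDr.
Qed.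

Lemma zspanMz d n : zspan d -> zspan (d *~ n).
Proof.
case=> f ->; exists (fun i => f i * n); rewrite mulrz_suml.
by apply: eq_bigr => i _; rewrite mulrzA.
Qed.

Lemma zspan_gen i : zspan (v i).
Proof.
exists (fun j => (j == i)%:Z); rewrite (bigD1 i) //= eqxx big1 ?addr0 // => j.
by move/negPf->.
Qed.

Lemma zspan_int n : zspan n%:~R.
Proof. by case: v1 => k <-; apply/zspanMz/zspan_gen. Qed.

Lemma zspanD d e : zspan d -> zspan e -> zspan (d + e).
Proof.
move=> [f ->] [g ->]; exists (fun i => f i + g i).
by rewrite -big_split; apply: eq_bigr => i _; rewrite mulrzDr.
Qed.

Lemma zspanN d : zspan d -> zspan (- d).
Proof. by move/(zspanMz (-1)); rewrite mulrN1z. Qed.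

Lemma zspanM d e : zspan d -> zspan e -> zspan (d * e).
Proof.
move=> [f ->] [g ->]; rewrite mulr_suml; apply: zspan_sum => i _.
rewrite mulr_sumr; apply: zspan_sum => j _.
rewrite mulrzAl mulrzAr; do 2!apply: zspanMz.
by have [k ->] := vM i j; apply: zspan_gen.
Qed.

(* Multiplication by [d] acts on the [v i] through an integer matrix [A], so
   [det (1 - q A)] annihilates 1, while it is 1 modulo [q]. *)
Lemma zspan_inv_nat q d : (1 < q)%N -> zspan d -> q%:R * d = 1 ->
  exists2 m, (0 < m)%N & m%:R = 0 :> D.
Proof.
move=> q1 Sd qd.
have [|A dA] := @fin_all_exists _ (fun=> 'I_N -> int)
    (fun i f => d * v i = \sum_j v j *~ f j).
  by move=> i; apply: zspanM Sd (zspan_gen i).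
pose B : 'M[int]_N := 1%:M - q%:R *: \matrix_(i, j) A i j.
have Bv i : \sum_j v j *~ B i j = 0.
  under eq_bigr => j _ do rewrite !mxE mulrzBr.
  rewrite sumrB (bigD1 i) //= eqxx big1 ?addr0; last first.
    by move=> j /negPf ne; rewrite eq_sym ne mulr0z.
  under eq_bigr => j _ do rewrite mulrC mulrzA.
  by rewrite -mulrz_suml -dA mulr1z natz -pmulrn -mulr_natl mulrA qd mul1r subrr.
have detv k : v k *~ \det B = 0.
  have: \sum_j v j *~ (\adj B *m B) k j = 0.
    under eq_bigr => j _ do rewrite mxE mulrz_sumr.
    rewrite exchange_big big1 // => i _ /=.
    under eq_bigr => j _ do rewrite mulrC mulrzA.
    by rewrite -mulrz_suml Bv mul0rz.
  rewrite mul_adj_mx (bigD1 k) //= big1 ?addr0; last first.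
    by move=> j /negPf ne; rewrite !mxE eq_sym ne mulr0z.
  by rewrite !mxE eqxx.
have nz_det : \det B != 0.
  apply: contraTneq (oner_neq0 'Z_q) => E; rewrite negbK.
  have <-: (\det B)%:~R = 1 :> 'Z_q; last by rewrite E.
  rewrite -det_map_mx -(det1 _ N); congr (\det _); apply/matrixP=> i j.
  rewrite !mxE rmorphB rmorphM /= mulrz_nat pchar_Zp // mul0r subr0.
  by case: (i == j).
have [k vk] := v1; exists `|\det B|%N; first by rewrite absz_gt0.
have := detv k; rewrite vk; case: (intP (\det B)) => // n.
by move=> /eqP; rewrite mulrNz oppr_eq0 abszN absz_nat -pmulrn => /eqP.
Qed.

Section PositiveChar.
Variable l : nat.
Hypotheses (l_gt0 : (0 < l)%N) (l0 : l%:R = 0 :> D).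

(** Coefficients only matter modulo [l]. *)
Lemma zspan_finite : exists s : seq D, forall d, zspan d <-> d \in s.
Proof.
have lz : l%:Z != 0 by rewrite eqz_nat -lt0n.
exists [seq \sum_i v i *+ f i | f : {ffun 'I_N -> 'I_l}] => d; split.
  case=> f ->; have lt i : (`|(f i %% l)%Z|%N < l)%N.
    by rewrite -ltz_nat gez0_abs ?ltz_pmod ?modz_ge0.
  apply/imageP; exists [ffun i => Ordinal (lt i)] => //.
  apply: eq_bigr => i _; rewrite ffunE /= {1}(divz_eq (f i) l) mulrzDr.
  rewrite mulrzA pmulrn gez0_abs ?modz_ge0 //.
  by rewrite -[_ *~ l]mulrzr -pmulrn l0 mulr0 add0r.
case/imageP=> f _ ->; exists (fun i => (f i : nat)%:Z).
by apply: eq_bigr => i _; rewrite pmulrn.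
Qed.

Lemma zspan_torsion d : zspan d -> d != 0 -> exists2 n, (0 < n)%N & d ^+ n = 1.
Proof.
move=> Sd nz_d; have [s sP] := zspan_finite.
have SX n : d ^+ n \in s.
  apply/sP; elim: n => [|n IH]; first by have := zspan_int 1.
  by rewrite exprS; apply: zspanM.
have: ~~ uniq [seq d ^+ i | i <- iota 0 (size s).+1].
  apply: contraT; rewrite negbK => us.
  have /(uniq_leq_size us): {subset [seq d ^+ i | i <- iota 0 (size s).+1] <= s}.
    by move=> _ /mapP[i _ ->].
  by rewrite size_map size_iota ltnn.
case/(uniqPn 0) => i [j [ltij]]; rewrite size_map size_iota => ltj.
rewrite !(nth_map 0%N) ?size_iota ?(ltn_trans ltij) // !nth_iota ?(ltn_trans ltij) //.
rewrite !add0n => E; exists (j - i)%N; first by rewrite subn_gt0.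
have U : d ^+ i \is a GRing.unit by rewrite unitrX ?divD.
by apply: (mulrI U); rewrite -exprD subnKC ?(ltnW ltij) // mulr1 E.
Qed.

Lemma zspan_commutative d e : zspan d -> zspan e -> d * e = e * d.
Proof.
have [s sP] := zspan_finite.
have s_ring : subring_closed (fun x => x \in s).
  split; first by apply/sP; apply: (zspan_int 1).
    by move=> x y /sP Sx /sP Sy; apply/sP; apply: zspanD => //; apply: zspanN.
  by move=> x y /sP Sx /sP Sy; apply/sP; apply: zspanM.
move=> /sP sd /sP se.
exact: (@fin_subring_commutative D (FinSubring s_ring) divD d e sd se).
Qed.

End PositiveChar.
End Zspan.

(** * Roots of unity *)

Section RootsOfUnity.
Variable D : unitRingType.
Hypothesis divD : is_division_ring D.
Implicit Types a b c e h x z : D.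

Definition torsion x := exists2 n, (0 < n)%N & x ^+ n = 1.

Lemma torsionM x y : x * y = y * x -> torsion x -> torsion y -> torsion (x * y).
Proof.
move=> xy [m m0 xm] [n n0 yn]; exists (m * n)%N; first by rewrite muln_gt0 m0.
by rewrite exprMn_comm // exprM xm expr1n mulnC exprM yn expr1n mulr1.
Qed.

Lemma torsionV x : torsion x -> torsion x^-1.
Proof. by case=> n n0 xn; exists n; rewrite // exprVn xn invr1. Qed.

(** Exponents count modulo [n], and reordering a product of monomials only costs powers of [e],
    which commutes with [a] and [b]. The case [m = 0] is that of commuting elements, [m = 1] that of
    class two. *)
Lemma monomial_family a b e n m : (0 < n)%N ->
    a ^+ n = 1 -> b ^+ n = 1 -> e ^+ n = 1 ->
    a * e = e * a -> b * e = e * b -> b * a = e ^+ m * a * b ->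
  exists (N : nat) (v : 'I_N -> D),
    [/\ exists k, v k = 1, forall i j, exists k, v i * v j = v k,
        [/\ zspan v e, zspan v a & zspan v b]
      & forall t, exists k i j, v t = e ^+ k * a ^+ i * b ^+ j].
Proof.
move=> n0 an bn en ae be ba.
pose w (s : 'I_n * 'I_n * 'I_n) := e ^+ s.1.1 * a ^+ s.1.2 * b ^+ s.2.
have wP k i j : exists t : 'I_#|{: 'I_n * 'I_n * 'I_n}|, e ^+ k * a ^+ i * b ^+ j = w (enum_val t).
  pose r i := Ordinal (ltn_pmod i n0).
  by exists (enum_rank (r k, r i, r j)); rewrite enum_rankK /w /= !expr_mod.
have baX j i : b ^+ j * a ^+ i = e ^+ (m * j * i) * a ^+ i * b ^+ j.
  have bX k : b * a ^+ k = e ^+ (m * k) * a ^+ k * b.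
    elim: k => [|k IH]; first by rewrite muln0 !expr0 mulr1 !mul1r.
    rewrite [a ^+ k.+1]exprS mulrA ba -!mulrA IH !mulrA; congr (_ * _ * _).
    by rewrite mulnS exprD -!mulrA; congr (_ * _); rewrite commrX_eq // !mulrA.
  elim: j => [|j IH]; first by rewrite muln0 mul0n !expr0 mulr1 !mul1r.
  rewrite [b ^+ j.+1]exprSr -mulrA bX !mulrA.
  have -> : b ^+ j * e ^+ (m * i) = e ^+ (m * i) * b ^+ j.
    by rewrite commrX_eq // -commrX_eq.
  by rewrite -(mulrA _ (b ^+ j)) IH !mulrA -exprD mulnS mulnDl.
pose v (t : 'I_#|{: 'I_n * 'I_n * 'I_n}|) := w (enum_val t).
exists #|{: 'I_n * 'I_n * 'I_n}|, v; split => //.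
- by have [t E] := wP 0%N 0%N 0%N; exists t; rewrite /v -E !expr0 !mulr1.
- move=> s t; rewrite /v; case: (enum_val s) => -[k i] j; case: (enum_val t) => -[k' i'] j'.
  have [u E] := wP (k + k' + m * j * i')%N (i + i')%N (j + j')%N.
  exists u; rewrite -E /w /=.
  have eC y (q q' : nat) : y * e = e * y -> y ^+ q * e ^+ q' = e ^+ q' * y ^+ q.
    by move=> ye; rewrite commrX_eq // -commrX_eq.
  rewrite !mulrA -(mulrA _ (b ^+ j) (e ^+ k')) eC // !mulrA.
  rewrite -(mulrA _ (a ^+ i) (e ^+ k')) eC // !mulrA -exprD.
  rewrite -(mulrA _ (b ^+ j)) baX !mulrA -(mulrA _ (a ^+ i)) eC // !mulrA -exprD.
  by rewrite -(mulrA _ (a ^+ i)) -exprD -(mulrA _ (b ^+ j)) -exprD.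
- have gP k i j x : x = e ^+ k * a ^+ i * b ^+ j -> zspan v x.
    by have [t ->] := wP k i j; move->; exact: (zspan_gen v t).
  split; [apply: (gP 1%N 0%N 0%N) | apply: (gP 0%N 1%N 0%N) | apply: (gP 0%N 0%N 1%N)];
    by rewrite !expr0 ?mulr1 ?mul1r.
- by move=> t; rewrite /v; case: (enum_val t) => -[k i] j; exists k, i, j.
Qed.

(** Each [1 - z ^+ i] is a multiple of [1 - z], and their sum over [i < n] is [n], because the
    powers of [z] sum to 0. *)
Lemma one_sub_root_dvd_nat z n : z ^+ n = 1 -> z != 1 ->
  (1 - z) * (\sum_(i < n) \sum_(j < i) z ^+ j) = n%:R.
Proof.
move=> zn z1.
have zs i : (1 - z) * (\sum_(j < i) z ^+ j) = 1 - z ^+ i.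
  by rewrite -[1 - z]opprB mulNr -subrX1 opprB.
rewrite mulr_sumr; under eq_bigr => i _ do rewrite zs.
have -> : \sum_(i < n) (1 - z ^+ i) = n%:R - \sum_(i < n) z ^+ i.
  by rewrite sumrB sumr_const card_ord.
have := zs n; rewrite zn subrr => /(div_mulf_eq0 divD)[/subr0_eq E|->].
  by rewrite E eqxx in z1.
by rewrite subr0.
Qed.

(** In the commutative ring generated by [c], [z1] and [z2], both [1 - z1] and [z2 - c] divide [n],
    so [q] divides [n ^ 2]. Being coprime to [n], [q] is invertible there, and [zspan_inv_nat]
    applies. *)
Lemma root_of_unity_equation_char c z1 z2 n q : (1 < q)%N -> (0 < n)%N ->
    coprime q n -> c ^+ n = 1 -> z1 ^+ n = 1 -> z2 ^+ n = 1 ->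
    c * z1 = z1 * c -> c * z2 = z2 * c -> z1 * z2 = z2 * z1 ->
    z1 != 1 -> z2 != c ->
    q%:R * ((1 - z2) * (z1 - c)) = (1 - z1) * (z2 - c) ->
  exists2 m, (0 < m)%N & m%:R = 0 :> D.
Proof.
move=> q1 n0 qn cn z1n z2n cz1 cz2 z12 z1_1 z2_c E.
have [|N [v [v1 vM [Sc S1 S2] vE]]] := monomial_family (m := 0) n0 z1n z2n cn (esym cz1) (esym cz2).
  by rewrite mul1r.
have zC x : x * c = c * x -> x * z1 = z1 * x -> x * z2 = z2 * x ->
    forall y, zspan v y -> x * y = y * x.
  move=> xc x1 x2 _ [f ->]; rewrite mulr_sumr mulr_suml; apply: eq_bigr => t _.
  rewrite mulrzAl mulrzAr; congr (_ *~ _); have [k [i [j ->]]] := vE t.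
  by do 2?[apply: commrM]; apply: commrX.
have SC x y : zspan v x -> zspan v y -> x * y = y * x.
  by move=> Sx; apply: (zC); apply/esym/(zC _ _ _ _ x Sx).
have SX x k : zspan v x -> zspan v (x ^+ k).
  move=> Sx; elim: k => [|k IH]; first exact: (zspan_int v1 1).
  by rewrite exprS; apply: zspanM.
have SB x y : zspan v x -> zspan v y -> zspan v (x - y).
  by move=> Sx Sy; apply: zspanD => //; apply: zspanN.
have S0 : zspan v 1 := zspan_int v1 1.
pose A z := \sum_(i < n) \sum_(j < i) z ^+ j : D.
have SA z : zspan v z -> zspan v (A z).
  by move=> Sz; do 2![apply: zspan_sum => ? _]; apply: SX.
pose c' := c ^+ n.-1; have cc' : c * c' = 1 by rewrite -exprS prednK.
have Sc' : zspan v c' by exact: (SX c).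
(* [w] is [z2 / c], so that [z2 - c = c * (w - 1)]. *)
pose w := c' * z2; have Sw : zspan v w by apply: zspanM.
have cw : c * w = z2 by rewrite mulrA cc' mul1r.
have w1 : w != 1 by apply: contraNneq z2_c => ww; rewrite -cw ww mulr1.
have wn : w ^+ n = 1.
  by rewrite exprMn_comm; [rewrite z2n exprAC cn expr1n mulr1 | apply: SC].
have SM := zspanM vM.
have A1 := one_sub_root_dvd_nat z1n z1_1; have Aw := one_sub_root_dvd_nat wn w1.
rewrite -/(A z1) in A1; rewrite -/(A w) in Aw.
(* The cofactors [A z1] and [A w] turn the equation into [q * g = - n ^ 2]. *)
pose g := (1 - z2) * (z1 - c) * A z1 * A w * c'.
have Sg : zspan v g.
  by rewrite /g; do 4![apply: (SM); last by auto]; auto.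
have qg : q%:R * g = - (n ^ 2)%:R.
  rewrite /g !mulrA -(mulrA q%:R) E.
  rewrite -(mulrA _ (z2 - c)) (SC (z2 - c)) ?mulrA; [|by auto|by auto].
  rewrite A1 -{1}cw -[X in c * w - X]mulr1 -mulrBr -[w - 1]opprB mulrN.
  rewrite mulrN !mulNr; congr (- _).
  rewrite -!mulrA; rewrite (mulrA _ _ c') Aw (SC n%:R c'); [|exact: zspan_int v1 n|by []].
  by rewrite (mulrA c) cc' mul1r -natrM mulnn.
(* Bezout: [a * q = b * n ^ 2 + 1], hence [a + b * g] is an inverse of [q]. *)
have [[a b] /= ab] := coprimeP (n ^ 2) (ltnW q1) (coprimeXr 2 qn).
have abE : (a * q)%N = (b * n ^ 2 + 1)%N
  by rewrite -(subnK (_ : b * n ^ 2 <= a * q)%N) ?ab 1?addnC // ltnW // -subn_gt0 ab.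
apply: (zspan_inv_nat v1 vM (q := q) (d := a%:R + b%:R * g)) => //.
  apply: zspanD; first exact: (zspan_int v1 a).
  by apply: SM => //; apply: (zspan_int v1 b).
rewrite mulrDr mulrA -natrM -natrM mulnC abE (natrM _ q) -(commr_nat) -mulrA qg.
by rewrite mulrN -natrM natrD addrAC subrr add0r.
Qed.

Lemma torsion_root_quotient c z l : (0 < l)%N -> l%:R = 0 :> D ->
    torsion c -> torsion z -> c * z = z * c -> z != c -> torsion (z - c).
Proof.
move=> l0 lD [m m0 cm] [n n0 zn] cz z_c.
have mn0 : (0 < m * n)%N by rewrite muln_gt0 m0.
have [||||||N [v [v1 vM [Sc Sz _] _]]] :=
  monomial_family (a := z) (b := 1) (e := c) (m := 0) mn0.
- by rewrite mulnC exprM zn expr1n.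
- by rewrite expr1n.
- by rewrite exprM cm expr1n.
- by [].
- by rewrite !mul1r mulr1.
- by rewrite !mul1r mulr1.
apply: (zspan_torsion divD v1 vM l0 lD); last by rewrite subr_eq0.
by apply: zspanD => //; apply: zspanN.
Qed.

(** The monomials in [c], [x] and [h] span a finite ring, commutative by Wedderburn's theorem. *)
Lemma torsion_class2_commute h x c l : (0 < l)%N -> l%:R = 0 :> D ->
    torsion h -> torsion x -> torsion c -> h * c = c * h -> x * c = c * x ->
  h * x = x * h * c -> h * x = x * h.
Proof.
move=> l0 lD [m m0 hm] [n n0 xn] [k k0 ck] hc xc hx.
have mnk0 : (0 < m * n * k)%N by rewrite !muln_gt0 m0 n0.
have [||||||N [v [v1 vM [_ Sx Sh] _]]] :=
  monomial_family (a := x) (b := h) (e := c) (m := 1) mnk0; rewrite //.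
- by rewrite mulnAC mulnC exprM xn expr1n.
- by rewrite -mulnA exprM hm expr1n.
- by rewrite mulnC exprM ck expr1n.
- by rewrite hx -mulrA hc !mulrA xc.
exact: (zspan_commutative divD v1 vM l0 lD Sh Sx).
Qed.

End RootsOfUnity.

(** * Centralizers of semicentral elements *)

Section Center.
Variable D : unitRingType.
Implicit Types x y : D.

Lemma in_center1 : in_center (1 : D).
Proof. by move=> y; rewrite mul1r mulr1. Qed.

Lemma in_centerM x y : in_center x -> in_center y -> in_center (x * y).
Proof. by move=> Zx Zy z; rewrite -mulrA Zy mulrA Zx mulrA. Qed.

Lemma in_centerX x n : in_center x -> in_center (x ^+ n).
Proof.
move=> Zx; elim: n => [|n IH]; first exact: in_center1.
by rewrite exprS; apply: in_centerM.
Qed.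

Lemma in_centerV x : in_center x -> in_center x^-1.
Proof. by move=> Zx z; rewrite commrV_eq. Qed.

Lemma in_centerN x : in_center x -> in_center (- x).
Proof. by move=> Zx z; rewrite mulNr mulrN Zx. Qed.

End Center.

Section MaximalSubgroup.
Variable D : unitRingType.
Hypothesis divD : is_division_ring D.
Implicit Types (a b c d g h m u x y : D).

(** Subtracting the relations gives [u (1 - c') = a u (c' - c)]: either [c = c'], which forces
    [c = 1], or [a] is a quotient of elements commuting with [u]. *)
Lemma one_add_gcomm_comm u a c c' : u != 0 ->
    u * a = a * u * c -> u * (1 + a) = (1 + a) * u * c' ->
    c * u = u * c -> c' * u = u * c' ->
  u * a = a * u.
Proof.
move=> nz_u ua u1a cu c'u; have Uu := divD nz_u.
have E : u * (1 - c') = a * (u * (c' - c)).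
  rewrite mulrDr mulr1 ua mulrDl mul1r mulrDl in u1a.
  by rewrite !mulrBr mulr1 !mulrA; apply/eqP; rewrite subr_eq addrAC eq_sym subr_eq u1a addrC.
have [Ec|ne] := eqVneq c c'.
  move: E; rewrite Ec subrr !mulr0 => /(div_mulf_eq0 divD)[/eqP|/subr0_eq c1].
    by rewrite (negPf nz_u).
  by rewrite ua Ec -c1 mulr1.
have Uc : c' - c \is a GRing.unit by apply: divD; rewrite subr_eq0 eq_sym.
have Uuc : u * (c' - c) \is a GRing.unit by rewrite unitrMr.
have -> : a = u * (1 - c') * (u * (c' - c))^-1 by rewrite E mulrK.
have cB : u * (1 - c') = (1 - c') * u by rewrite mulrBr mulrBl mulr1 mul1r c'u.
have cC : u * (c' - c) = (c' - c) * u by rewrite mulrBr mulrBl c'u cu.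
have uV : u * (u * (c' - c))^-1 = (u * (c' - c))^-1 * u.
  by apply: commrV_eq; rewrite -mulrA cC.
by rewrite -[RHS]mulrA -uV !mulrA -(mulrA u _ u) -cB !mulrA.
Qed.

Variable M : D -> Prop.
Hypothesis maxM : maximal_subgroup M.
Hypothesis nilM : locally_nilpotent M.

Lemma maxM_subgroup : is_subgroup M. Proof. by case: maxM. Qed.
Let sM := maxM_subgroup.
Let UM x : M x -> x \is a GRing.unit. Proof. exact: subgroup_unit. Qed.

Definition gens (s : seq D) := gen (fun x => x \in s).

Lemma gensP s : (forall x, x \in s -> M x) ->
  [/\ is_subgroup (gens s), subset_of (gens s) M &
      exists n, forall x, gens s x -> ucs (gens s) n x].
Proof.
move=> sSM; have sG : is_subgroup (gens s) by apply: gen_subgroup sM _.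
split=> //; last by apply: nilpotent_ucs => //; apply: nilM.
by move=> x; apply.
Qed.

Lemma engelM x y : M x -> M y -> exists n, iter n (fun z => gcomm z x) y = 1.
Proof.
move=> Mx My; have sSM z : z \in [:: x; y] -> M z.
  by rewrite !inE => /orP[] /eqP->.
have [sG _ _] := gensP sSM; apply: engel sG (nilM sSM) _ _.
  by apply: gen_sub; rewrite inE eqxx.
by apply: gen_sub; rewrite !inE eqxx orbT.
Qed.

Lemma gens_center s x : (forall y, y \in s -> M y) -> gens s x ->
  (forall y, y \in s -> x * y = y * x) -> ucs (gens s) 1 x.
Proof.
move=> sSM Gx xs; have [sG _ _] := gensP sSM; apply/(ucs1P _ sG); split=> // g Gg.
by apply: gen_comm Gg => // y /sSM; apply: UM.
Qed.

(** By [one_add_gcomm_comm], the second center of the group generated by the four elements is its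
    center, so this nilpotent group is abelian. *)
Lemma nilpotent_additive_comm a b : M a -> M b -> M (1 + a) -> M (1 + b) ->
  a * b = b * a.
Proof.
move=> Ma Mb Ma1 Mb1; apply: NNPP => nab.
pose s := [:: a; b; 1 + a; 1 + b].
have sSM x : x \in s -> M x.
  by rewrite !inE => /or4P[] /eqP->.
have [sG GM [n Gn]] := gensP sSM.
have Gs x : x \in s -> gens s x by move=> xs; apply: gen_sub.
have Ga : gens s a by apply: Gs; rewrite inE eqxx.
have Gb : gens s b by apply: Gs; rewrite !inE eqxx orbT.
have [|u [Z2 Z1]] := ucs_witness sG (Gn a Ga) (k := 1).
  by move/(ucs1P _ sG) => -[_ /(_ b Gb)].
have [Gu Zu] := Z2.
have Uu := subgroup_unit sG Gu.
have nz_u : u != 0 by rewrite -div_unitE.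
have ucomm x : x \in s -> 1 + x \in s -> u * x = x * u.
  move=> xs x1s; have Z y : y \in s -> gcomm u y * u = u * gcomm u y.
    by move=> ys; have /(ucs1P _ sG)[_] := Zu y (Gs y ys); apply.
  apply: (one_add_gcomm_comm nz_u _ _ (Z x xs) (Z _ x1s)).
    by apply: mulr_gcomm => //; apply/UM/sSM.
  by apply: mulr_gcomm => //; apply/UM/sSM.
have ua : u * a = a * u by apply: ucomm; rewrite !inE eqxx ?orbT.
have ub : u * b = b * u by apply: ucomm; rewrite !inE eqxx ?orbT.
apply: Z1; apply: gens_center => // y; rewrite !inE.
by case/or4P=> /eqP-> //; rewrite mulrDr mulrDl mulr1 mul1r ?ua ?ub.
Qed.

(** Conjugation by [m] changes [h] only by a central factor, so it preserves the centralizer of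
    [h]. *)
Lemma conj_comm h m c d : m \is a GRing.unit -> h * m = m * h * c ->
  in_center c -> d * h = h * d -> (m * d * m^-1) * h = h * (m * d * m^-1).
Proof.
move=> Um hm Zc dh; have Vh : m^-1 * h = h * c * m^-1.
  by apply: (mulrI Um); rewrite mulVKr // !mulrA -hm mulrK.
by rewrite -mulrA Vh !mulrA hm -(mulrA m d) dh -(mulrA _ c d) Zc !mulrA.
Qed.

Definition semicentral h := [/\ M h, ~ in_center h & forall m, M m -> in_center (gcomm h m)].

Lemma semicentral_conj h m d : semicentral h -> M m -> d * h = h * d ->
  (m * d * m^-1) * h = h * (m * d * m^-1).
Proof.
case=> Mh _ Zh Mm dh; apply: (conj_comm (UM Mm) _ (Zh m Mm) dh).
by apply: mulr_gcomm; apply: UM.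
Qed.

(* Otherwise [C_D(h)^* M] is all of [D^*], so that [C_D(h)] is normalized by
   [D^*], and the Cartan-Brauer-Hua argument makes [h] central. *)
Lemma semicentral_centralizer h d : semicentral h -> d \is a GRing.unit ->
  d * h = h * d -> M d.
Proof.
move=> sh; have [Mh nZh _] := sh.
(* [H] is a group because [M] normalizes the centralizer of [h]. *)
pose H x := exists d m, [/\ d \is a GRing.unit, d * h = h * d, M m & x = d * m].
have sH : is_subgroup H.
  split.
  - by exists 1, 1; rewrite unitr1 !mulr1 mul1r; split=> //; apply: subgroup1.
  - by move=> _ [e [m [Ue _ Mm ->]]]; rewrite unitrMl // UM.
  - move=> _ _ [e [m [Ue eh Mm ->]]] [e' [m' [Ue' eh' Mm' ->]]].
    have Um := UM Mm; exists (e * (m * e' * m^-1)), (m * m'); split.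
    + by rewrite !unitrMl ?unitrV.
    + by rewrite -mulrA (semicentral_conj sh) // !mulrA eh.
    + exact: subgroupM.
    + by rewrite !mulrA mulrVK.
  - move=> _ [e [m [Ue eh Mm ->]]]; have Um := UM Mm.
    have MV := subgroupV sM Mm.
    exists (m^-1 * e^-1 * m^-1^-1), m^-1; split=> //.
    + by rewrite !unitrMl ?unitrV.
    + by apply: (semicentral_conj sh MV); rewrite -commrV_eq.
    + by rewrite invrK invrM // mulrK.
have MH : subset_of M H.
  by move=> m Mm; exists 1, m; rewrite unitr1 mulr1 !mul1r.
have [_ _ /(_ H sH MH)[HM Ud dh|allH]] := maxM.
  by apply: HM; exists d, 1; rewrite mulr1; split=> //; apply: subgroup1.
have inv a : a \is a GRing.unit -> (a * h * a^-1) * h = h * (a * h * a^-1).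
  move=> Ua; have [e [m [Ue eh Mm ->]]] := allH a Ua.
  have Um := UM Mm; have E := semicentral_conj sh Mm (erefl (h * h)).
  have -> : e * m * h * (e * m)^-1 = e * (m * h * m^-1) * e^-1.
    by rewrite invrM // !mulrA.
  by apply: (conj_comm Ue _ (@in_center1 D) E); rewrite mulr1.
case: nZh => a; apply: NNPP => nah.
have nz_a : a != 0 by apply: contra_not_neq nah => ->; rewrite mulr0 mul0r.
have nz_a1 : 1 + a != 0.
  apply: contra_not_neq nah => /eqP; rewrite addrC addr_eq0 => /eqP->.
  by rewrite mulrN mulNr mulr1 mul1r.
have Ua := divD nz_a; have Ua1 := divD nz_a1.
(* The conjugates [p] and [q] satisfy [(p - q) * a = q - h]. If [p = q] then both equal [h];
   otherwise [a] is a quotient of elements commuting with [h]. *)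
pose p := a * h * a^-1; pose q := (1 + a) * h * (1 + a)^-1.
have pa : p * a = a * h by rewrite mulrVK.
have qa : q + q * a = h + p * a.
  by rewrite -{1}[q]mulr1 -mulrDr mulrVK // mulrDl mul1r pa.
have E : (p - q) * a = q - h.
  by rewrite mulrBl; apply/eqP; rewrite subr_eq addrAC eq_sym subr_eq qa addrC.
have [pq|npq] := eqVneq p q.
  move: E; rewrite pq subrr mul0r => /esym/subr0_eq qh; apply: nah.
  by rewrite -pa pq qh.
have Upq : p - q \is a GRing.unit by apply: divD; rewrite subr_eq0.
apply: nah; have hp : h * p = p * h by rewrite -inv.
have hq : h * q = q * h by rewrite -inv.
have -> : a = (p - q)^-1 * (q - h) by rewrite -E mulKr.
have hpq : h * (p - q) = (p - q) * h by rewrite mulrBr mulrBl hp hq.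
by rewrite mulrA (commrV_eq hpq) -!mulrA mulrBr mulrBl hq.
Qed.

(** Apart from the trivial values 0 and -1, the elements [d], [e], [1 + d] and [1 + e] all lie in
    [M]. *)
Lemma semicentral_centralizer_comm h d e : semicentral h ->
  d * h = h * d -> e * h = h * e -> d * e = e * d.
Proof.
move=> sh dh eh.
have [->|nz_d] := eqVneq d 0; first by rewrite mulr0 mul0r.
have [->|nz_e] := eqVneq e 0; first by rewrite mulr0 mul0r.
have [/eqP|nz_d1] := eqVneq (1 + d) 0.
  by rewrite addrC addr_eq0 => /eqP->; rewrite mulrN mulNr mulr1 mul1r.
have [/eqP|nz_e1] := eqVneq (1 + e) 0.
  by rewrite addrC addr_eq0 => /eqP->; rewrite mulrN mulNr mulr1 mul1r.
by apply: nilpotent_additive_comm; apply: (semicentral_centralizer sh);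
  rewrite ?divD // mulrDl mulrDr mulr1 mul1r ?dh ?eh.
Qed.

(** A central [M] would lie in the centralizer of the noncentral [x]; by maximality that centralizer
    is in [M], making [x] central, or contains [y]. *)
Lemma maxM_not_central : (exists x y : D, x * y != y * x) ->
  exists h, M h /\ ~ in_center h.
Proof.
move=> [x [y /eqP xy]]; apply: NNPP => nE.
have ZM h : M h -> in_center h by move=> Mh; apply: NNPP => nZ; apply: nE; exists h.
have nz_x : x != 0 by apply: contra_not_neq xy => ->; rewrite mulr0 mul0r.
have nz_y : y != 0 by apply: contra_not_neq xy => ->; rewrite mulr0 mul0r.
have [_ _] := maxM; case/(_ _ (centralizer_subgroup x)).
- by move=> m Mm; split; [apply: UM | rewrite (ZM m Mm)].
- by move=> CM; apply: xy; apply: ZM; apply: CM; rewrite divD.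
- by case/(_ y (divD nz_y)).
Qed.

Lemma central_maxM_subfield h : M h -> ~ in_center h ->
    (forall m, M m -> h * m = m * h) ->
  exists K : D -> Prop, maximal_subfield K /\ (forall x, M x <-> (K x /\ x != 0)).
Proof.
move=> Mh nZh hM; have sh : semicentral h.
  split=> // m Mm; have -> : gcomm h m = 1 by apply/gcomm1P; auto.
  exact: in_center1.
have cC := semicentral_centralizer_comm sh.
(* A subfield containing the centralizer of [h] contains [h], hence centralizes it. *)
exists (fun x => x * h = h * x); split; last first.
  move=> x; split=> [Mx|[xh nz_x]]; first by rewrite hM // -div_unitE // UM.
  by apply: (semicentral_centralizer sh); rewrite ?divD.
split=> [|L [_ [_ [_ [_ [_ LC]]]]] KL x Lx]; last by apply: LC => //; apply: KL.
split; first by rewrite mulr0 mul0r.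
split; first by rewrite mulr1 mul1r.
split; first by move=> x y xh yh; rewrite mulrBl mulrBr xh yh.
split; first by move=> x y xh yh; rewrite -mulrA yh mulrA xh mulrA.
by split=> [x xh _|x y]; [rewrite -commrV_eq | apply: cC].
Qed.

End MaximalSubgroup.

(** * Absence of semicentral elements *)

Section NoSemicentral.
Variable D : unitRingType.
Hypothesis divD : is_division_ring D.
Variable M : D -> Prop.
Hypothesis maxM : maximal_subgroup M.
Hypothesis nilM : locally_nilpotent M.
Hypothesis algM : set_algebraic_over_center (derived_subgroup M).
Implicit Types (a b c d h k m t u w x y z : D).

Let sM := maxM_subgroup maxM.
Let UM x : M x -> x \is a GRing.unit. Proof. exact: subgroup_unit. Qed.
Let sC h d : semicentral M h -> d \is a GRing.unit -> d * h = h * d -> M d.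
Proof. exact: semicentral_centralizer. Qed.
Let sCC h d e : semicentral M h -> d * h = h * d -> e * h = h * e -> d * e = e * d.
Proof. exact: semicentral_centralizer_comm. Qed.

Lemma gcomm_comm z x y : x \is a GRing.unit -> y \is a GRing.unit ->
  z * x = x * z -> z * y = y * z -> z * gcomm x y = gcomm x y * z.
Proof.
move=> Ux Uy zx zy.
by case: (subgroup_gcomm (centralizer_subgroup z) (conj Ux zx) (conj Uy zy)).
Qed.

Lemma gcommX_central h x n : M h -> M x -> in_center (gcomm h x) ->
  gcomm (h ^+ n) x = gcomm h x ^+ n.
Proof.
move=> Mh Mx Zc; have [Uh Ux] := (UM Mh, UM Mx).
apply: gcomm_eq; rewrite ?unitrX //; elim: n => [|n IH].
  by rewrite !expr0 !mulr1 mul1r.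
rewrite exprS -mulrA IH exprS !mulrA (mulr_gcomm Uh Ux).
by rewrite -(mulrA _ (gcomm h x) (h ^+ n)) Zc !mulrA.
Qed.

Lemma semicentralX h n : semicentral M h -> ~ in_center (h ^+ n) ->
  semicentral M (h ^+ n).
Proof.
case=> Mh _ Zh nZ; split=> // [|m Mm]; first exact: subgroupX.
by rewrite gcommX_central ?Zh //; [apply: in_centerX|]; apply: Zh.
Qed.

Lemma semicentral_gcomm_torsion h x : semicentral M h -> M x ->
  torsion (gcomm h x).
Proof.
move=> sh Mx; have [Mh nZh Zh] := sh; set c := gcomm h x.
have [c1|c1] := eqVneq c 1; first by exists 1%N => //; rewrite expr1.
have [Uh Ux] := (UM Mh, UM Mx).
have Zc : in_center c := Zh x Mx.
have Uc : c \is a GRing.unit by apply: UM; apply: subgroup_gcomm.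
have hX i : h * x ^+ i = x ^+ i * (h * c ^+ i).
  have /= := mulr_expr_gcomm i (mulr_gcomm Uh Ux) (c := 1).
  by rewrite !mulr1 !mul1r expr1n mulr1 mulrA; apply=> //; rewrite Zc.
(* [f i] is the conjugate of [1 + h] by [x ^+ i]. *)
pose f i := 1 + h * c ^+ i.
have f0 : f 0%N = 1 + h by rewrite /f expr0 mulr1.
have nzf i : f i != 0.
  apply: contra_not_neq nZh => /eqP; rewrite /f addrC addr_eq0 => /eqP E.
  have -> : h = - (c ^- i) by apply: (mulIr (unitrX i Uc)); rewrite E mulNr mulVr ?unitrX.
  by apply/in_centerN/in_centerV/in_centerX.
have Uf i := divD (nzf i).
have fX j i : f j * x ^+ i = x ^+ i * f (i + j)%N.
  rewrite /f mulrDl mulrDr mul1r mulr1 -mulrA (in_centerX j Zc) mulrA hX.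
  by rewrite -!mulrA exprD.
have fh i : f i * h = h * f i.
  by rewrite /f mulrDl mulrDr mul1r mulr1 -mulrA (in_centerX i Zc).
(* Algebraicity says nothing about [c], which is central, so it is applied to [[1 + h, x]]. Its
   conjugates by powers of [x] are the [v i], which commute because they centralize [h]. *)
pose v i := (f i)^-1 * f i.+1.
have vh i : v i * h = h * v i.
  by rewrite /v -mulrA fh mulrA -commrV_eq ?fh // mulrA.
have v0 : v 0%N = gcomm (1 + h) x.
  symmetry; apply: gcomm_eq; rewrite -?f0 // /v mulrA.
  have := fX 0%N 1%N; rewrite expr1 addn0 => ->.
  by rewrite mulrK.
have vf j : f j * v j = f j.+1 by rewrite mulVKr.
have M1 : M (1 + h) by apply: (sC sh); rewrite -f0.
have alg0 : algebraic_over_center (v 0%N).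
  by apply: algM; rewrite v0; apply: gen_sub; exists (1 + h), x.
have [|i j|n n0 vn] := algebraic_conj_comm divD alg0 Ux (v := v).
- by move=> i; apply: (mulrI (Uf 0%N)); rewrite !mulrA mulrV // mul1r !fX addn1 addn0 mulrK.
- by apply: (sCC sh).
exists n => //.
have E : (f n) * v 0%N = f n.+1.
  apply: (mulrI (unitrX n Ux)); transitivity (f 0%N * v 0%N * x ^+ n).
    by rewrite -(mulrA (f 0%N)) vn (mulrA (f 0%N)) fX addn0 -(mulrA (x ^+ n)).
  by rewrite vf fX addn1.
have E0 : f 0%N * v 0%N = f 1%N by rewrite vf.
move: (v 0%N) E E0 => b E E0.
(* [h] cancels between [f 0 * b = f 1] and [f n * b = f n.+1] once the first is multiplied by
   [c ^+ n]. *)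
have: (c ^+ n - 1) * (b - 1) = 0.
  have : c ^+ n * (f 0%N * b) - f n * b = c ^+ n * f 1%N - f n.+1 by rewrite E E0.
  have -> : c ^+ n * f 1%N - f n.+1 = c ^+ n - 1.
    rewrite /f mulrDr mulr1 expr1 (in_centerX n Zc) -mulrA -exprS.
    by rewrite opprD addrACA subrr addr0.
  have -> : c ^+ n * (f 0%N * b) - f n * b = (c ^+ n - 1) * b.
    rewrite mulrA -mulrBl f0 /f mulrDr mulr1 (in_centerX n Zc h).
    by rewrite opprD addrACA subrr addr0.
  by rewrite mulrBr mulr1 => ->; rewrite subrr.
case/(div_mulf_eq0 divD) => /subr0_eq // v01.
move: E0; rewrite v01 mulr1 f0 /f expr1 => /addrI.
by rewrite -[LHS]mulr1 => /(mulrI Uh) c1'; rewrite -c1' eqxx in c1.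
Qed.

(** If [[h, x]] has order [m] and [p] is a prime factor of [m], then [k = h ^+ (m / p)] works, the
    commutator with [x] being multiplicative on powers of [h]. *)
Lemma semicentral_prime_gcomm h x : semicentral M h -> M x -> gcomm h x != 1 ->
  exists k p, [/\ semicentral M k, prime p, gcomm k x != 1 & gcomm k x ^+ p = 1].
Proof.
move=> sh Mx c1; have [n n0 cn] := semicentral_gcomm_torsion sh Mx.
have [Mh nZh Zh] := sh.
have [m prim_c _] := prim_order_exists n0 cn.
have m1 : (1 < m)%N.
  rewrite ltn_neqAle (prim_order_gt0 prim_c) andbT; apply: contraNneq c1 => m1.
  by have := prim_expr_order prim_c; rewrite -m1 expr1 => ->.
pose p := pdiv m; have p_pr : prime p := pdiv_prime m1.
have p_m : (p %| m)%N := pdiv_dvd m.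
clearbody p; have p_gt0 := prime_gt0 p_pr; have p_gt1 := prime_gt1 p_pr.
have m_gt0 := ltnW m1.
have E := gcommX_central (m %/ p)%N Mh Mx (Zh x Mx).
have c1' : gcomm (h ^+ (m %/ p)%N) x != 1.
  rewrite E -(prim_order_dvd prim_c) gtnNdvd ?ltn_Pdiv //.
  by rewrite divn_gt0 // dvdn_leq.
exists (h ^+ (m %/ p)%N), p; split=> //; last first.
  by rewrite E -exprM divnK // (prim_expr_order prim_c).
apply: semicentralX sh _ => Z; case/eqP: c1'.
by apply/gcomm1P; rewrite ?unitrX ?UM.
Qed.

(** [[y, x]] is [y^-1] times a conjugate of [y] by an element of [M], and both factors centralize
    [k]. *)
Lemma semicentral_gcomm_comm k x y : semicentral M k -> M x ->
  y \is a GRing.unit -> y * k = k * y -> gcomm y x * k = k * gcomm y x.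
Proof.
move=> sk Mx Uy yk.
have := semicentral_conj maxM sk (subgroupV sM Mx) yk; rewrite invrK => E.
have -> : gcomm y x = y^-1 * (x^-1 * y * x) by rewrite /gcomm !mulrA.
move: (x^-1 * y * x) E => P E.
by rewrite -mulrA E mulrA -(commrV_eq (esym yk)) -mulrA.
Qed.

(* Engel's condition for [x] acting on [w], pushed down with the norm: when
   [gcomm v x] is fixed by [x] and [v] by [x ^+ p], its [p]-th power is 1. *)
Lemma gcomm_ppower_torsion k x w p n : semicentral M k -> M x ->
    w \is a GRing.unit -> w * k = k * w -> w * x ^+ p = x ^+ p * w ->
    iter n.+1 (fun z => gcomm z x) w = 1 ->
  gcomm w x ^+ (p ^ n) = 1.
Proof.
move=> sk Mx; have Ux := UM Mx.
have conjC y := semicentral_gcomm_comm (y := y) sk Mx.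
elim: n w => [|n IH] w Uw wk wx; first by rewrite expn0 expr1.
rewrite iterSr => Ew'.
have Uw' : gcomm w x \is a GRing.unit.
  by rewrite /gcomm !unitrMl ?unitrV.
have w'k := conjC w Uw wk.
have w'x : gcomm w x * x ^+ p = x ^+ p * gcomm w x.
  apply/esym/gcomm_comm => //; last exact: (esym (commrX_eq p (erefl (x * x)))).
have := IH _ Uw' w'k w'x Ew'; set q := (p ^ n)%N => Eq.
have w''k := conjC _ Uw' w'k.
have wC := sCC sk.
(* The induction hypothesis makes [x] fix [v'], and [v' = [v, x]] because [w] and [[w, x]]
   commute. *)
pose v := w ^+ q; pose v' := gcomm w x ^+ q.
have v'x : v' * x = x * v'.
  by rewrite /v' (expr_mulr_gcomm q (mulr_gcomm Uw' Ux) (wC _ _ w'k w''k)) Eq mulr1.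
have vx : v * x = x * v * v' by apply: expr_mulr_gcomm (mulr_gcomm Uw Ux) (wC _ _ wk w'k).
have := mulr_expr_gcomm p vx (c := 1); rewrite !mulr1 !mul1r expr1n mulr1.
move=> /(_ v'x erefl erefl).
have -> : v * x ^+ p = x ^+ p * v.
  exact: (esym (commrX_eq q (esym wx))).
rewrite -[LHS]mulr1 => /mulrI; rewrite unitrMl ?unitrX // => /(_ isT).
by rewrite -exprM expnSr => <-.
Qed.

(** Take [z = [t + k, x]]: since [x] fixes [t], expanding [(t + k) x = x (t + k) z] gives
    [(t + k) z = t + k c]. *)
Lemma semicentral_translate_root k x t p c : semicentral M k -> M x ->
    c = gcomm k x -> c != 1 -> c ^+ p = 1 ->
    t * k = k * t -> t * x = x * t ->
  exists z n, [/\ z ^+ (p ^ n) = 1, z * k = k * z & k * (z - c) = t * (1 - z)].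
Proof.
move=> sk Mx Ec c1 cp tk tx; have [Mk nZk Zk] := sk.
have [Uk Ux] := (UM Mk, UM Mx).
have kx : k * x = x * k * c by rewrite Ec; apply: mulr_gcomm.
have Zc : in_center c by rewrite Ec; apply: Zk.
have nz_u : t + k != 0.
  apply: contra_neq c1 => /eqP; rewrite addrC addr_eq0 => /eqP E.
  by rewrite Ec; apply/gcomm1P; rewrite // E mulNr mulrN tx.
have Uu := divD nz_u.
have uk : (t + k) * k = k * (t + k) by rewrite mulrDl mulrDr tk.
have Mu : M (t + k) by apply: (sC sk).
(* With no commutation at all, [t + k = 1], so [k] would commute with [x]. *)
have [[|n] En] := engelM maxM nilM Mx Mu.
  have E : k = 1 - t by rewrite -En /= addrAC subrr add0r.
  by case/eqP: c1; rewrite Ec; apply/gcomm1P; rewrite // E mulrBl mulrBr tx mulr1 mul1r.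
have kX : k * x ^+ p = x ^+ p * k.
  have := mulr_expr_gcomm p kx (c := 1).
  by rewrite !mulr1 !mul1r cp expr1n !mulr1; apply.
exists (gcomm (t + k) x), n; split.
- apply: gcomm_ppower_torsion sk Mx Uu uk _ En.
  by rewrite mulrDl mulrDr kX commrX_eq.
- exact: semicentral_gcomm_comm.
have E := mulr_gcomm Uu Ux; move: (gcomm (t + k) x) E => z E.
have {}E : t * z + k * z = t + k * c.
  by rewrite -mulrDl; apply: (mulrI Ux); rewrite mulrA -E mulrDl mulrDr tx kx mulrA.
apply/eqP; rewrite !mulrBr mulr1 subr_eq addrAC -E.
by rewrite [t * z + _]addrC addrK.
Qed.

Lemma no_semicentral h :
  (forall g, M g -> (forall m, M m -> g * m = m * g) -> in_center g) ->
  ~ semicentral M h.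
Proof.
move=> ZM sh; have [Mh nZh Zh] := sh.
have [x [Mx c1]] : exists x, M x /\ gcomm h x != 1.
  apply: NNPP => nE; apply: nZh; apply: ZM => // m Mm.
  apply/gcomm1P; try exact: UM.
  by apply/eqP; apply: contraT => ne; case: nE; exists m.
have {h sh Mh nZh Zh c1} [k [p [sk p_pr c1 cp]]] := semicentral_prime_gcomm sh Mx c1.
have [Mk nZk Zk] := sk; have [Uk Ux] := (UM Mk, UM Mx).
have p_gt0 := prime_gt0 p_pr; have p_gt1 := prime_gt1 p_pr.
set c := gcomm k x in c1 cp; have Zc : in_center c by apply: Zk.
have nz_k : k != 0 by rewrite -div_unitE.
have wC := sCC sk.
have ck : c * k = k * c := Zc k.
have root t : t != 0 -> t * k = k * t -> t * x = x * t ->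
  exists z n, [/\ z ^+ (p ^ n) = 1, z * k = k * z, k * (z - c) = t * (1 - z),
                  z != c & z != 1].
  move=> nz_t tk tx.
  have [z [n [zn zk E]]] := semicentral_translate_root sk Mx erefl c1 cp tk tx.
  exists z, n; split=> //; apply/eqP=> Ez; move: E; rewrite Ez subrr mulr0.
    move/esym/(div_mulf_eq0 divD) => [|/subr0_eq E]; first exact/eqP.
    by rewrite E eqxx in c1.
  move/(div_mulf_eq0 divD) => [|/subr0_eq E]; first exact/eqP.
  by rewrite E eqxx in c1.
have [z1 [n1 [z1n z1k E1 z1c z11]]] : exists z n, [/\ z ^+ (p ^ n) = 1,
    z * k = k * z, k * (z - c) = 1 * (1 - z), z != c & z != 1].
  by apply: root; rewrite ?oner_neq0 // mulr1 mul1r.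
rewrite mul1r in E1; have z1C := wC _ _ ck z1k.
case: (classic (exists2 l, (0 < l)%N & l%:R = 0 :> D)) => [[l l0 lD]|char0].
  have tc : torsion c by exists p.
  have t1 : torsion z1 by exists (p ^ n1)%N; rewrite // expn_gt0 p_gt0.
  have t0 : torsion (1 : D) by exists 1%N.
  (* From [t = 1]: [k = (1 - z1) / (z1 - c)] is a quotient of torsion elements. *)
  have tk : torsion k.
    have U : z1 - c \is a GRing.unit by rewrite divD ?subr_eq0.
    rewrite -[k](mulrK U) E1; apply: torsionM.
    - apply: commrV_eq; apply: wC; first by rewrite mulrBl mulrBr mulr1 mul1r z1k.
      by rewrite mulrBl mulrBr z1k ck.
    - by apply: (torsion_root_quotient divD l0 lD) => //; rewrite ?mulr1 ?mul1r // eq_sym.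
    - by apply: torsionV; apply: (torsion_root_quotient divD l0 lD).
  have kx : k * x = x * k * c by apply: mulr_gcomm.
  have kX : x ^+ p * k = k * x ^+ p.
    have := mulr_expr_gcomm p kx (c := 1).
    by rewrite !mulr1 !mul1r cp expr1n !mulr1 => ->.
  (* The choice [t = x ^+ p] is allowed because [c ^+ p = 1]; it expresses [x ^+ p] through torsion
     elements. *)
  have [||z [n [zn zk E zc z_1]]] := root (x ^+ p) _ kX.
  - by rewrite -(div_unitE divD) unitrX.
  - by rewrite -exprSr exprS.
  have tx : torsion x.
    have U : 1 - z \is a GRing.unit by rewrite divD // subr_eq0 eq_sym.
    have tz : torsion z by exists (p ^ n)%N; rewrite // expn_gt0 p_gt0.
    have [m m0 xm] : torsion (x ^+ p).
      rewrite -[x ^+ p](mulrK U) -E; apply: torsionM.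
      - apply: commrV_eq; apply: wC; last by rewrite mulrBl mulrBr mulr1 mul1r zk.
        by rewrite -mulrA; congr (_ * _); rewrite mulrBl mulrBr zk ck.
      - apply: torsionM => //; first by rewrite mulrBl mulrBr zk ck.
        exact: (torsion_root_quotient divD l0 lD).
      - apply: torsionV; apply: (torsion_root_quotient divD l0 lD) => //.
          by rewrite mulr1 mul1r.
        by rewrite eq_sym.
    by exists (p * m)%N; [rewrite muln_gt0 p_gt0 | rewrite exprM].
  have kxC := torsion_class2_commute divD l0 lD tk tx tc (esym ck) (esym (Zc x)) kx.
  by case/eqP: c1; apply/gcomm1P.
have nz_q : p.+1%:R != 0 :> D.
  by apply/eqP=> E; apply: char0; exists p.+1.
have [||z2 [n2 [z2n z2k E2 z2c _]]] := root p.+1%:R nz_q.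
- exact: (esym (commr_nat _ _)).
- exact: (esym (commr_nat _ _)).
(* [n] is a common exponent of [c], [z1] and [z2], and a power of [p], hence coprime to [p + 1].
   Eliminating [k] between [E1] and [E2] gives the required equation. *)
apply: char0; pose n := (p ^ (n1 + n2).+1)%N.
apply: (@root_of_unity_equation_char D divD c z1 z2 n p.+1) => //.
- by rewrite expn_gt0 p_gt0.
- by rewrite coprimeXr // coprimeSn.
- by rewrite /n expnS exprM cp expr1n.
- by rewrite /n -addnS expnD exprM z1n expr1n.
- by rewrite /n -addSn expnD mulnC exprM z2n expr1n.
- exact: wC.
- rewrite mulrA -E2 -E1.
  have A : (z2 - c) * k = k * (z2 - c) by rewrite mulrBl mulrBr z2k ck.
  have B : (z1 - c) * k = k * (z1 - c) by rewrite mulrBl mulrBr z1k ck.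
  by rewrite -!mulrA (wC _ _ A B).
Qed.

End NoSemicentral.

(** * Torsion elements are central *)

Section Class2.
Variable D : unitRingType.
Implicit Types (x y u v w g d e : D) (G : D -> Prop).

Lemma exprM_gcomm w v e n : v * w = w * v * e -> e * w = w * e -> e * v = v * e ->
  (w * v) ^+ n = w ^+ n * v ^+ n * e ^+ 'C(n, 2).
Proof.
move=> vw ew ev.
have eX k y : e * y = y * e -> e ^+ k * y = y * e ^+ k.
  by move=> ey; rewrite (commrX_eq k (esym ey)).
elim: n => [|n IH]; first by rewrite !expr0 !mulr1.
rewrite exprSr IH mulrA -(mulrA _ (e ^+ _) w) eX // mulrA -(mulrA _ (v ^+ n) w).
rewrite (expr_mulr_gcomm n vw (esym ev)) !mulrA.
rewrite -(mulrA _ (e ^+ _) v) eX // !mulrA binS bin1 addnC exprD !mulrA.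
rewrite -(mulrA _ (e ^+ n) v) eX // !mulrA [w ^+ n.+1]exprSr [v ^+ n.+1]exprSr.
by rewrite !mulrA.
Qed.

Lemma ucs2_gcomm G u g : is_subgroup G -> ucs G 2 u -> G g ->
  [/\ G (gcomm u g), forall g', G g' -> gcomm u g * g' = g' * gcomm u g
    & forall n, u * g ^+ n = g ^+ n * u * gcomm u g ^+ n].
Proof.
move=> sG Z2u Gg; have Gu := ucs_sub sG Z2u.
have /(ucs1P _ sG)[Gd dC] : ucs G 1 (gcomm u g) by case: Z2u => _; apply.
split=> // n.
have /= := mulr_expr_gcomm n (mulr_gcomm (subgroup_unit sG Gu) (subgroup_unit sG Gg)) (c := 1).
by rewrite !mulr1 !mul1r expr1n mulr1; apply=> //; apply: dC.
Qed.

Lemma ucs3_gcomm G y g n : is_subgroup G -> ucs G 3 y -> G g ->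
  y * g ^+ n = g ^+ n * y * gcomm y g ^+ n * gcomm (gcomm y g) g ^+ 'C(n, 2).
Proof.
move=> sG Z3y Gg; have Gy := ucs_sub sG Z3y.
have Z2u : ucs G 2 (gcomm y g) by case: Z3y => _; apply.
have Gu := ucs_sub sG Z2u.
have [Gc cC _] := ucs2_gcomm sG Z2u Gg.
by apply: mulr_expr_gcomm (cC _ Gg) (cC _ Gu); apply: mulr_gcomm; exact: subgroup_unit sG _.
Qed.

Lemma gcommMr y g h d e : y * g = g * y * d -> y * h = h * y * e -> d * h = h * d ->
  y * (g * h) = g * h * y * (e * d).
Proof.
move=> yg yh dh; rewrite mulrA yg -(mulrA _ d) dh !mulrA -(mulrA _ y h) yh.
by rewrite !mulrA.
Qed.

End Class2.

(** * Elements of prime order *)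

Section ElementsOfPrimeOrder.
Variable D : unitRingType.
Hypothesis divD : is_division_ring D.
Variable M : D -> Prop.
Hypothesis maxM : maximal_subgroup M.
Hypothesis nilM : locally_nilpotent M.
Hypothesis noSC : forall h : D, ~ semicentral M h.
Implicit Types (a b c d g h i m t u v w x y z : D).

Let sM := maxM_subgroup maxM.
Let UM x : M x -> x \is a GRing.unit. Proof. exact: subgroup_unit. Qed.

Lemma semicentral_in_center h : M h -> (forall m, M m -> in_center (gcomm h m)) ->
  in_center h.
Proof. by move=> Mh Zh; apply: NNPP => nZ; apply: (noSC (h := h)). Qed.

Lemma centralizing_in_center h : M h -> (forall m, M m -> h * m = m * h) -> in_center h.
Proof.
move=> Mh hM; apply: semicentral_in_center => // m Mm.
have -> : gcomm h m = 1 by apply/gcomm1P; auto.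
exact: in_center1.
Qed.

(** For [y] in the third center, the [g] with [[y, g]] central form a subgroup, so a failure already
    occurs at a generator, where information on powers is available. *)
Lemma nilpotent_class3_witness (s : seq D) : (forall x, x \in s -> M x) ->
  (forall x, gens s x -> ucs (gens s) 2 x) \/
  exists y g, [/\ g \in s, ucs (gens s) 3 y,
    ucs (gens s) 2 (gcomm y g) & ~ ucs (gens s) 1 (gcomm y g)].
Proof.
move=> sSM; have [sG GM [n Gn]] := gensP maxM nilM sSM.
case: (classic (forall x, gens s x -> ucs (gens s) 2 x)) => [|nZ]; first by left.
have [x nx] := not_all_ex_not _ _ nZ; have [Gx nZx] := imply_to_and _ _ nx.
have [y [Z3y nZ2y]] := ucs_witness sG (Gn x Gx) nZx.
right; apply: NNPP => nE; apply: nZ2y; have Gy := ucs_sub sG Z3y.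
have Uy := subgroup_unit sG Gy.
pose H g := [/\ gens s g, g \is a GRing.unit & ucs (gens s) 1 (gcomm y g)].
suff HG g : gens s g -> H g by split=> // g /HG[].
rewrite /gens /gen; move/(_ H); apply; last first.
  move=> g' sg'; have Gg' : gens s g' by apply: gen_sub.
  split=> //; first exact: subgroup_unit Gg'.
  apply: NNPP => nZ1; apply: nE; exists y, g'; split=> //.
  by case: Z3y => _; apply.
split=> [|g' []|g' h [Gg' Ug' Zg'] [Gh Uh Zh]|g' [Gg' Ug' Zg']] //.
- split; [exact: subgroup1 sG | exact: unitr1 | apply/(ucs1P _ sG)].
  have -> : gcomm y 1 = 1 by apply/gcomm1P; rewrite ?unitr1 // mulr1 mul1r.
  by split=> [|z _]; [exact: subgroup1 sG | rewrite mulr1 mul1r].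
- split; [exact: subgroupM sG Gg' Gh | by rewrite unitrMl |apply/(ucs1P _ sG)].
  move/(ucs1P _ sG): Zg' => [Gd dC]; move/(ucs1P _ sG): Zh => [Ge eC].
  have -> : gcomm y (g' * h) = gcomm y h * gcomm y g'.
    apply: gcomm_eq; rewrite ?unitrMl //.
    by apply: gcommMr; [apply: mulr_gcomm | apply: mulr_gcomm | apply: dC].
  split=> [|z Gz]; first exact: subgroupM sG Ge Gd.
  by rewrite -mulrA dC // mulrA eC // mulrA.
- split; [exact: subgroupV sG Gg' | by rewrite unitrV |apply/(ucs1P _ sG)].
  move/(ucs1P _ sG): Zg' => [Gd dC].
  have Ud := subgroup_unit sG Gd.
  have -> : gcomm y g'^-1 = (gcomm y g')^-1.
    move: (gcomm y g') (mulr_gcomm Uy Ug') dC Ud {Gd} => d Ed dC Ud.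
    apply: gcomm_eq; rewrite ?unitrV //; apply: (mulIr Ud); rewrite mulrVK //.
    apply: (mulrI Ug'); rewrite mulVKr // -[y * _ * _]mulrA.
    by rewrite -(commrV_eq (dC _ Gg')) !mulrA -Ed mulrK.
  split=> [|z Gz]; first exact: subgroupV sG Gd.
  by apply/esym/commrV_eq; rewrite dC.
Qed.

Lemma order_prime_in_center p w : prime p -> M w -> w ^+ p = 1 -> in_center w.
Proof.
move=> p_pr Mw wp; have [->|w1] := eqVneq w 1; first exact: in_center1.
have Uw := UM Mw.
apply: centralizing_in_center => // m Mm; have Um := UM Mm.
pose w' := m^-1 * w * m; have wm : w * m = m * w' by rewrite /w' -mulrA mulVKr.
have Mw' : M w' by apply: subgroupM => //; apply: subgroupM => //; apply: subgroupV.
have wmX k : w ^+ k * m = m * w' ^+ k.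
  elim: k => [|k IH]; first by rewrite mulr1 mul1r.
  by rewrite exprSr -mulrA wm mulrA IH -mulrA -exprSr.
have w'p : w' ^+ p = 1 by apply: (mulrI Um); rewrite -wmX wp mul1r mulr1.
case: (classic (w * w' = w' * w)) => ww'.
  have [k Ek] := prime_order_comm_power divD p_pr wp w1 w'p ww'.
  (* [j] stands for [k - 1] modulo [p], so that [[w, m] = w ^+ j] and [n] commutations with [m] give
     [w ^+ (j ^ n)]. *)
  pose j := (k + p.-1)%N; have p_gt0 := prime_gt0 p_pr.
  have Ej : w * w ^+ j = w'.
    by rewrite -exprS /j -addnS prednK // exprD wp mulr1 -Ek.
  have step n : gcomm (w ^+ n) m = w ^+ (n * j).
    apply: gcomm_eq; rewrite ?unitrX // wmX -Ej exprMn_comm; last first.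
      by rewrite /GRing.comm -exprS exprSr.
    by rewrite -exprM mulnC mulrA.
  have [n] := engelM maxM nilM Mm Mw.
  have -> : iter n (fun z => gcomm z m) w = w ^+ (j ^ n).
    elim: n => [|n IH]; first by rewrite expr1.
    by rewrite iterS IH step expnSr.
  have prim_w := prime_primitive_root p_pr wp w1.
  move/eqP; rewrite -(prim_order_dvd prim_w) (Euclid_dvdX _ _ p_pr).
  case/andP; rewrite (prim_order_dvd prim_w) => /eqP wj1 _.
  by rewrite wm -Ej wj1 mulr1.
have sSM x : x \in [:: w; w'] -> M x by rewrite !inE => /orP[] /eqP->.
have [sG GM [n Gn]] := gensP maxM nilM sSM; set G := gens _ in sG GM Gn.
have Gs x : x \in [:: w; w'] -> G x by move=> xs; apply: gen_sub.
have Gw : G w by apply: Gs; rewrite inE eqxx.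
have Gw' : G w' by apply: Gs; rewrite !inE eqxx orbT.
have [|u [Z2 Z1]] := ucs_witness sG (Gn w Gw) (k := 1).
  by move/(ucs1P _ sG) => -[_ /(_ w' Gw')].
case: Z1; have Gu := ucs_sub sG Z2.
(* [[u, g]] is central in [G] with [p]-th power 1: if nontrivial, it has [g] among its powers, so
   [u] commutes with [g] anyway. *)
suff uC g : g \in [:: w; w'] -> u * g = g * u by exact: (gens_center maxM nilM sSM Gu).
move=> gs; have Gg := Gs g gs; have gp : g ^+ p = 1.
  by move: gs; rewrite !inE => /orP[] /eqP->.
have [Gd dC uX] := ucs2_gcomm sG Z2 Gg.
have dp : gcomm u g ^+ p = 1.
  by apply: (mulrI (UM (GM _ Gu))); have := uX p; rewrite gp !mulr1 mul1r => <-.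
have [d1|d1] := eqVneq (gcomm u g) 1.
  by apply/gcomm1P => //; apply/UM/GM.
have [k ->] := prime_order_comm_power divD p_pr dp d1 gp (dC _ Gg).
by rewrite -commrX_eq // dC.
Qed.

End ElementsOfPrimeOrder.

(** * Square roots of -1 *)

Section SquareRootsOfMinusOne.
Variable D : unitRingType.
Hypothesis divD : is_division_ring D.
Variable M : D -> Prop.
Hypothesis maxM : maximal_subgroup M.
Hypothesis nilM : locally_nilpotent M.
Hypothesis noSC : forall h : D, ~ semicentral M h.
Implicit Types (a b c d g h i m t u v w x y z : D).

Let sM := maxM_subgroup maxM.
Let UM x : M x -> x \is a GRing.unit. Proof. exact: subgroup_unit. Qed.

Lemma sqr_neg1_comm_pm x y : x * y = y * x -> x ^+ 2 = -1 -> y ^+ 2 = -1 ->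
  x = y \/ x = - y.
Proof. by move=> xy x2 y2; apply: sqr_eq_comm => //; rewrite x2 y2. Qed.

Lemma order8_sqr_comm t t' : M t -> M t' -> t ^+ 4 = -1 -> t' ^+ 4 = -1 ->
  t ^+ 2 * t' ^+ 2 = t' ^+ 2 * t ^+ 2.
Proof.
move=> Mt Mt' t4 t4'; set a := t ^+ 2; set b := t' ^+ 2; apply: NNPP => nab.
have a2 : a ^+ 2 = -1 by rewrite -exprM.
have b2 : b ^+ 2 = -1 by rewrite -exprM.
have sSM x : x \in [:: t; t'] -> M x by rewrite !inE => /orP[] /eqP->.
have [sG GM _] := gensP maxM nilM sSM; set G := gens _ in sG GM.
have Gs x : x \in [:: t; t'] -> G x by move=> xs; apply: gen_sub.
have Gt : G t by apply: Gs; rewrite inE eqxx.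
have Gt' : G t' by apply: Gs; rewrite !inE eqxx orbT.
have Ga : G a := subgroupX 2 sG Gt.
have Gb : G b := subgroupX 2 sG Gt'.
(* Such a [d] would be [a] or [- a], and [a] would commute with [b]. *)
have no_root d : d ^+ 2 = -1 -> a * d = d * a -> b * d = d * b -> False.
  move=> d2 ad bd; apply: nab.
  by case: (sqr_neg1_comm_pm ad a2 d2) => ->; rewrite ?mulNr ?mulrN bd.
have key d : d ^+ 8 = 1 -> a * d = d * a -> b * d = d * b -> d ^+ 2 = 1.
  move=> d8 ad bd; have d42 : (d ^+ 4) ^+ 2 = 1 by rewrite -exprM.
  case: (sqr_eq1_pm divD d42) => d4.
    have d22 : (d ^+ 2) ^+ 2 = 1 by rewrite -exprM.
    by case: (sqr_eq1_pm divD d22) => // d2; case: (no_root d).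
  by case: (no_root (d ^+ 2)); rewrite -?exprM // commrX_eq.
have t8 g : g \in [:: t; t'] -> g ^+ 8 = 1.
  by rewrite !inE => /orP[] /eqP->; rewrite (exprM _ 4 2) ?t4 ?t4' sqrrN expr1n.
have dC u g : ucs G 2 u -> g \in [:: t; t'] -> gcomm u g ^+ 2 = 1.
  move=> Z2 gs; have [_ dC uX] := ucs2_gcomm sG Z2 (Gs g gs).
  apply: key; try by rewrite dC.
  by apply: (mulrI (UM (GM _ (ucs_sub sG Z2)))); have := uX 8; rewrite (t8 g gs) mul1r => <-.
have uab u g : ucs G 2 u -> g \in [:: t; t'] -> u * g ^+ 2 = g ^+ 2 * u.
  move=> Z2 gs; have [_ _ ->] := ucs2_gcomm sG Z2 (Gs g gs).
  by rewrite dC // mulr1.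
have ts : t \in [:: t; t'] by rewrite inE eqxx.
have ts' : t' \in [:: t; t'] by rewrite !inE eqxx orbT.
case: (nilpotent_class3_witness maxM nilM sSM) => [Z2|[y [g [gs Z3y Z2u nZ1u]]]].
  by apply: nab; rewrite -commrX_eq // (uab t t' (Z2 t Gt) ts').
(* The binomial ['C(8, 2)] is even, so the formula leaves [[y, g] ^+ 8 = 1]; then [key] gives
   [[y, g] = 1] or [-1]. *)
have := ucs3_gcomm 8 sG Z3y (Gs g gs).
have -> : gcomm (gcomm y g) g ^+ 'C(8, 2) = 1.
  by rewrite (_ : 'C(8, 2) = (2 * 14)%N) // exprM (dC _ _ Z2u gs) expr1n.
rewrite (t8 g gs) mulr1 mul1r mulr1 -[LHS]mulr1.
move/(mulrI (UM (GM _ (ucs_sub sG Z3y))))/esym => u8.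
have u2 : gcomm y g ^+ 2 = 1 by apply: key => //; rewrite (uab _ _ Z2u).
apply: nZ1u; apply: (gens_center maxM nilM sSM (ucs_sub sG Z2u)) => x _.
by case: (sqr_eq1_pm divD u2) => ->; rewrite ?mulNr ?mulrN mulr1 mul1r.
Qed.

(** Here [[z, x] = z ^- 2], so each Engel step squares [z] up to inversion. *)
Lemma inverted_2power x z : M x -> M z -> z * x = x * z^-1 ->
  exists n, z ^+ (2 ^ n) = 1.
Proof.
move=> Mx Mz; have [n] := engelM maxM nilM Mx Mz; have Uz := UM Mz.
move=> En zx; exists n; elim: n z Uz zx En {Mz} => [|n IH] z Uz zx; first by rewrite expr1.
have zVX : (z^-1 ^+ 2)^-1 = z ^+ 2 by rewrite exprVn invrK.
have -> : iter n.+1 (fun y => gcomm y x) z = iter n (fun y => gcomm y x) (z^-1 ^+ 2).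
  rewrite iterSr; congr (iter n _ _); apply: gcomm_eq; rewrite ?(UM Mx) //.
  by rewrite zx expr2 !mulrA mulrK.
move/IH; rewrite unitrX ?unitrV // zVX => /(_ isT) H.
have /H : z^-1 ^+ 2 * x = x * z ^+ 2.
  have zVx : z^-1 * x = x * z.
    by apply: (mulrI Uz); rewrite mulVKr // mulrA zx mulrVK.
  by rewrite expr2 -mulrA zVx mulrA zVx -mulrA expr2.
by rewrite -exprM -expnS exprVn => /(congr1 GRing.inv); rewrite invrK invr1.
Qed.

Lemma gcomm_pm_in_center q m e : M q -> M m -> in_center e ->
  q * m = m * (q * e) -> in_center (gcomm q m).
Proof.
move=> Mq Mm Ze E; rewrite (_ : gcomm q m = e) //.
by apply: gcomm_eq; rewrite ?UM // E mulrA.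
Qed.

Lemma in_center_neg1 : in_center (-1 : D).
Proof. exact/in_centerN/in_center1. Qed.

(* Otherwise the square roots of -1 in [M] are [+-i], [+-j] and [+-ij] for some
   conjugate [j] of [i], and taking commutators never leaves this set. *)
Lemma sqr_neg1_in_center i : M i -> i ^+ 2 = -1 -> in_center i.
Proof.
move=> Mi i2; apply: NNPP => nZi.
have ne1 : -1 != 1 :> D.
  apply: contra_not_neq nZi => E.
  by apply: (order_prime_in_center divD maxM nilM noSC (p := 2)); rewrite // i2.
pose X w := M w /\ w ^+ 2 = -1.
have MN w : M w -> M (- w).
  by move=> Mw; rewrite -mulN1r -i2; apply: subgroupM => //; apply: subgroupX.
have nZX w : X w -> ~ in_center w.
  move=> [_ w2] Zw; apply: nZi.
  by case: (sqr_neg1_comm_pm (esym (Zw i)) i2 w2) => ->; rewrite //; apply: in_centerN.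
pose cj q m := m^-1 * q * m.
have cjE q m : M m -> q * m = m * cj q m.
  by move=> Mm; rewrite /cj -mulrA mulVKr // UM.
have cjX q m : X q -> M m -> X (cj q m).
  move=> [Mq q2] Mm; split.
    by apply: subgroupM => //; apply: subgroupM => //; apply: subgroupV.
  apply: (mulrI (UM Mm)); rewrite expr2 mulrA -cjE // -mulrA -cjE // mulrA -expr2 q2.
  by rewrite mulrN1 mulN1r.
(* Otherwise every [[q, m]] is 1 or -1, and [q] would be semicentral. *)
have cj_pm q : X q -> exists m, [/\ M m, cj q m <> q & cj q m <> - q].
  move=> Xq; apply: NNPP => nE; apply: (nZX q Xq).
  apply: (semicentral_in_center noSC); first by case: Xq.
  move=> m Mm; have [Mq _] := Xq; have E := cjE q m Mm.
  case: (classic (cj q m = q)) => [Eq|nq].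
    by apply: (gcomm_pm_in_center (e := 1)) => //; [exact: in_center1 | rewrite E Eq mulr1].
  case: (classic (cj q m = - q)) => [Eq|nnq]; last by case: nE; exists m.
  apply: (gcomm_pm_in_center (e := -1)) => //; first exact: in_center_neg1.
  by rewrite E Eq mulrN1.
(* [t ^+ 2] commutes with its conjugates by [order8_sqr_comm], so these are all [t ^+ 2] up to sign,
   against [cj_pm]. *)
have no8 t : M t -> t ^+ 4 <> -1.
  move=> Mt t4; have Xa : X (t ^+ 2) by split; [apply: subgroupX | rewrite -exprM].
  have [m [Mm nq nnq]] := cj_pm _ Xa.
  have Mt' : M (cj t m).
    by apply: subgroupM => //; apply: subgroupM => //; apply: subgroupV.
  have cjM n : cj (t ^+ n) m = cj t m ^+ n.
    elim: n => [|n IH]; first by rewrite /cj mulr1 mulVr ?UM.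
    apply: (mulrI (UM Mm)); rewrite -cjE // !exprS [RHS]mulrA -cjE // -!mulrA.
    by congr (_ * _); rewrite -IH -cjE.
  have t4' : cj t m ^+ 4 = -1.
    rewrite -cjM t4; apply: (mulrI (UM Mm)); rewrite -cjE //.
    by rewrite mulrN1 mulN1r.
  have := order8_sqr_comm Mt Mt' t4 t4'; rewrite -cjM => C.
  have [_ c2] := cjX _ _ Xa Mm; have [_ a2] := Xa.
  by case: (sqr_neg1_comm_pm (esym C) c2 a2).
have pow2 n y : M y -> y ^+ (2 ^ n) = 1 -> [\/ y = 1, y = -1 | y ^+ 2 = -1].
  elim: n y => [|n IH] y My; first by rewrite expr1 => ->; constructor 1.
  rewrite expnS exprM => /(IH _ (subgroupX 2 sM My))[] y2.
  - by case: (sqr_eq1_pm divD y2) => ->; [constructor 1 | constructor 2].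
  - by constructor 3.
  - by case: (no8 y My); rewrite (exprM y 2 2).
(* [x] inverts [w * x], which therefore has 2-power order and is 1, -1 or a square root of -1. *)
have anti w x : X w -> X x -> [\/ w = x, w = - x | w * x = - (x * w)].
  move=> [Mw w2] [Mx x2].
  have Uw := UM Mw; have Ux := UM Mx.
  have wV : w^-1 = - w by apply: (mulrI Uw); rewrite mulrV // mulrN -expr2 w2 opprK.
  have xV : x^-1 = - x by apply: (mulrI Ux); rewrite mulrV // mulrN -expr2 x2 opprK.
  have Mwx : M (w * x) by apply: subgroupM.
  have inv : (w * x) * x = x * (w * x)^-1.
    by rewrite -mulrA -expr2 x2 invrM // wV xV mulrNN mulrA -expr2 x2 mulrN1 mulN1r.
  have [n /(pow2 _ _ Mwx)[] E] := inverted_2power Mx Mwx inv.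
  - by constructor 2; apply: (mulIr Ux); rewrite E mulNr -expr2 x2 opprK.
  - by constructor 1; apply: (mulIr Ux); rewrite E -expr2 x2.
  - constructor 3; apply: (mulrI Uw); apply: (mulIr Ux).
    transitivity (- (w * x) ^+ 2); last by rewrite expr2 mulrN mulNr !mulrA.
    by rewrite E opprK mulrA -expr2 w2 -mulrA -expr2 x2 mulrNN mulr1.
have [mi [Mmi ni nni]] := cj_pm i (conj Mi i2).
pose j := cj i mi; have Xi : X i by []; have Xj : X j by apply: cjX.
have ij : i * j = - (j * i).
  by case: (anti i j Xi Xj) => // E; [case: ni | case: nni; rewrite -/j E opprK].
pose k := i * j; have [[_ j2] Mj] := (Xj, Xj.1).
have Xk : X k.
  split; first exact: subgroupM.
  by rewrite expr2 /k {1}ij mulNr -mulrA (mulrA i i) -expr2 i2 mulN1r mulrN opprK -expr2.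
(* An element anticommuting with [i] and [j] commutes with [k = i * j]; as -1 is not 1, it cannot
   anticommute with [k] too. *)
have Xijk w : X w -> exists q, [/\ q \in [:: i; j; k] & w = q \/ w = - q].
  move=> Xw.
  case: (anti w i Xw Xi) => [E|E|wi]; [by exists i; rewrite inE eqxx; split; auto| |].
    by exists i; rewrite inE eqxx; split; auto.
  case: (anti w j Xw Xj) => [E|E|wj]; [by exists j; rewrite !inE eqxx orbT; split; auto| |].
    by exists j; rewrite !inE eqxx orbT; split; auto.
  case: (anti w k Xw Xk) => [E|E|wk]; [by exists k; rewrite !inE eqxx !orbT; split; auto| |].
    by exists k; rewrite !inE eqxx !orbT; split; auto.
  have E : w * k = k * w by rewrite /k mulrA wi mulNr -(mulrA i w j) wj mulrN opprK mulrA.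
  have /eqP := wk; rewrite E -addr_eq0 -mulr2n -mulr_natl => /eqP.
  case/(div_mulf_eq0 divD) => [/eqP|/eqP].
    by rewrite mulrS addr_eq0 eq_sym (negPf ne1).
  by rewrite -(negbK (_ == _)) -(div_unitE divD) UM //; apply: subgroupM; [|case: Xk|case: Xw].
have [mj [Mmj nj nnj]] := cj_pm j Xj; have [mk [Mmk nk nnk]] := cj_pm k Xk.
pose s := [:: i; mi; mj; mk].
have sSM x : x \in s -> M x by rewrite !inE => /or4P[] /eqP->.
have [sG GM [n Gn]] := gensP maxM nilM sSM.
have Gs x : x \in s -> gens s x by move=> xs; apply: gen_sub.
(* [[q, m]] is minus the product of [q] and its conjugate, which anticommute, so its square is -1
   again. *)
have step q : X q -> exists g, gens s g /\ X (gcomm q g).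
  have base q' m : X q' -> M m -> cj q' m <> q' -> cj q' m <> - q' -> X (gcomm q' m).
    move=> Xq' Mm nq nnq; have [Mq q2] := Xq'; have [Mc c2] := cjX _ _ Xq' Mm.
    split; first exact: subgroup_gcomm.
    have -> : gcomm q' m = - (q' * cj q' m).
      apply: gcomm_eq; rewrite ?UM // cjE // -mulrA; congr (_ * _).
      by rewrite mulrN mulrA -expr2 q2 mulN1r opprK.
    have A : q' * cj q' m = - (cj q' m * q').
      by case: (anti _ _ Xq' (cjX _ _ Xq' Mm)) => // E; [case: nq | case: nnq; rewrite [in RHS]E opprK].
    rewrite sqrrN expr2 {1}A mulNr -mulrA (mulrA q' q') -expr2 q2 mulN1r mulrN opprK.
    by rewrite -expr2 c2.
  have gN q' m : M q' -> M m -> gcomm (- q') m = gcomm q' m.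
    move=> Mq' Mm; apply: gcomm_eq; rewrite ?unitrN ?UM //.
    by rewrite mulNr mulrN mulNr -mulr_gcomm ?UM.
  move=> Xq; have [q' [q's Eq]] := Xijk q Xq.
  have [m [ms Xm]] : exists m, m \in s /\ X (gcomm q' m).
    move: q's; rewrite !inE => /or3P[] /eqP->.
    - by exists mi; rewrite !inE eqxx !orbT; split=> //; apply: base.
    - by exists mj; rewrite !inE eqxx !orbT; split=> //; apply: base.
    - by exists mk; rewrite !inE eqxx !orbT; split=> //; apply: base.
  exists m; split; first exact: Gs.
  case: Eq => ->; rewrite ?gN //; last exact: sSM.
  by move: q's; rewrite !inE => /or3P[] /eqP-> //; case: Xk.
have nucs l q : X q -> ~ ucs (gens s) l q.
  elim: l q => [|l IH] q Xq /=.
    by move=> q1; case: Xq; rewrite q1 expr1n => _ E; rewrite -E eqxx in ne1.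
  by case=> _ Zq; have [g [Gg Xg]] := step q Xq; apply: (IH _ Xg); apply: Zq.
have si : i \in s by rewrite !inE eqxx.
exact: nucs n i Xi (Gn i (Gs i si)).
Qed.

End SquareRootsOfMinusOne.

(** * The derived subgroup is central *)

Section DerivedSubgroup.
Variable D : unitRingType.
Hypothesis divD : is_division_ring D.
Variable M : D -> Prop.
Hypothesis maxM : maximal_subgroup M.
Hypothesis nilM : locally_nilpotent M.
Hypothesis noSC : forall h : D, ~ semicentral M h.
Implicit Types (a b c d e g h i m t u v w x y z : D).

Let sM := maxM_subgroup maxM.
Let UM x : M x -> x \is a GRing.unit. Proof. exact: subgroup_unit. Qed.

(** For odd [p], [p] divides ['C(p, 2)] and [v ^+ p = 1]; for [p = 2], [v ^+ 2] is 1 or -1. *)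
Lemma expr_binomial2_in_center p v e : prime p -> M v -> e ^+ p = 1 ->
  v ^+ p = e ^+ 'C(p, 2) -> in_center v.
Proof.
move=> p_pr Mv ep vp; have [p2|p_odd] := even_prime p_pr.
  move: ep vp; rewrite p2 expr1 => e2 v2.
  case: (sqr_eq1_pm divD e2) v2 => -> v2.
    exact: (order_prime_in_center divD maxM nilM noSC (p := 2)).
  exact: (sqr_neg1_in_center divD maxM nilM noSC).
apply: (order_prime_in_center divD maxM nilM noSC p_pr Mv).
have p_gt2 : (2 < p)%N by apply: odd_prime_gt2.
by rewrite vp -(divnK (prime_dvd_bin p_pr (k := 2) _)) ?p_gt2 // mulnC exprM ep expr1n.
Qed.

Lemma prime_root_in_center p w : prime p -> M w -> in_center (w ^+ p) -> in_center w.
Proof.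
move=> p_pr Mw Zwp; have Uw := UM Mw.
apply: (semicentral_in_center noSC) => // m Mm; have Um := UM Mm.
set v := gcomm w m; have Mv : M v by apply: subgroup_gcomm.
pose w' := w * v; have wm : w * m = m * w' by rewrite /w' (mulrA m) -mulr_gcomm.
have Mw' : M w' by apply: subgroupM.
have w'p : w' ^+ p = w ^+ p.
  have wmX k : w ^+ k * m = m * w' ^+ k.
    elim: k => [|k IH]; first by rewrite mulr1 mul1r.
    by rewrite exprSr -mulrA wm mulrA IH -mulrA -exprSr.
  by apply: (mulrI Um); rewrite -wmX Zwp.
have sSM x : x \in [:: w; w'] -> M x by rewrite !inE => /orP[] /eqP->.
have [sG GM _] := gensP maxM nilM sSM; set G := gens _ in sG GM.
have Gs x : x \in [:: w; w'] -> G x by move=> xs; apply: gen_sub.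
have Gw : G w by apply: Gs; rewrite inE eqxx.
have Gw' : G w' by apply: Gs; rewrite !inE eqxx orbT.
have Zgp g : g \in [:: w; w'] -> in_center (g ^+ p).
  by rewrite !inE => /orP[] /eqP->; rewrite ?w'p.
have cp u g : ucs G 2 u -> g \in [:: w; w'] -> gcomm u g ^+ p = 1.
  move=> Z2u gs; have [_ _ /(_ p)] := ucs2_gcomm sG Z2u (Gs g gs).
  have Uug : u * g ^+ p \is a GRing.unit.
    have Uu := UM (GM _ (ucs_sub sG Z2u)); have Ug := UM (GM _ (Gs g gs)).
    by rewrite unitrMl ?unitrX.
  by rewrite (Zgp g gs) -[LHS]mulr1 => /(mulrI Uug).
case: (nilpotent_class3_witness maxM nilM sSM) => [Z2|[y [g [gs Z3y Z2u nZ1u]]]].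
  (* In class two, expanding [(w * v) ^+ p = w ^+ p] gives [v ^+ p * e ^+ 'C(p, 2) = 1] with [e =
     [v, w]]. *)
  have Gv : G v.
    have -> : v = w^-1 * w' by rewrite mulKr.
    exact: subgroupM sG (subgroupV sG Gw) Gw'.
  have ws : w \in [:: w; w'] by rewrite inE eqxx.
  have [Ge eC _] := ucs2_gcomm sG (Z2 v Gv) Gw.
  have := exprM_gcomm p (mulr_gcomm (UM Mv) Uw) (eC _ Gw) (eC _ Gv).
  rewrite -/w' w'p -mulrA -[LHS]mulr1 => /(mulrI (unitrX p Uw)) E.
  have Ue := UM (GM _ Ge).
  apply: (expr_binomial2_in_center p_pr Mv (e := (gcomm v w)^-1)).
    by rewrite exprVn (cp _ _ (Z2 v Gv) ws) invr1.
  by apply: (mulIr (unitrX 'C(p, 2) Ue)); rewrite -E exprVn mulVr ?unitrX.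
(* Moving [y] across the central [g ^+ p] gives the same relation for [u = [y, g]] and [[u, g]]. *)
case: nZ1u; have Gu := ucs_sub sG Z2u.
have Gg := Gs g gs; have [Gc _ _] := ucs2_gcomm sG Z2u Gg.
have Uc := UM (GM _ Gc).
apply: (gens_center maxM nilM sSM Gu) => x _; move: x.
apply: (expr_binomial2_in_center p_pr (GM _ Gu) (e := (gcomm (gcomm y g) g)^-1)).
  by rewrite exprVn (cp _ _ Z2u gs) invr1.
have := ucs3_gcomm p sG Z3y Gg; rewrite (Zgp g gs) -mulrA -[LHS]mulr1.
have Uyg : y * g ^+ p \is a GRing.unit.
  have Uy := UM (GM _ (ucs_sub sG Z3y)); have Ug := UM (GM _ Gg).
  by rewrite unitrMl ?unitrX.
move/(mulrI Uyg) => E.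
by apply: (mulIr (unitrX 'C(p, 2) Uc)); rewrite -E exprVn mulVr ?unitrX.
Qed.

Lemma power_in_center n x : (0 < n)%N -> M x -> in_center (x ^+ n) -> in_center x.
Proof.
elim/ltn_ind: n x => n IH x n0 Mx; have [->|n1] := eqVneq n 1%N; first by rewrite expr1.
have n_gt1 : (1 < n)%N by rewrite ltn_neqAle eq_sym n1.
have p_pr := pdiv_prime n_gt1; have p_n := pdiv_dvd n.
move: (pdiv n) p_pr p_n => p p_pr p_n Zxn; have p_gt0 := prime_gt0 p_pr.
have dn0 : (0 < n %/ p)%N by rewrite divn_gt0 // dvdn_leq.
apply: (IH (n %/ p)%N); rewrite ?ltn_Pdiv ?prime_gt1 //.
apply: (prime_root_in_center p_pr); first exact: subgroupX.
by rewrite -exprM divnK.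
Qed.

Lemma torsion_in_center x : M x -> torsion x -> in_center x.
Proof.
by move=> Mx [n n0 xn]; apply: (power_in_center n0 Mx); rewrite xn; apply: in_center1.
Qed.

Hypothesis algM : set_algebraic_over_center (derived_subgroup M).

Lemma derived_sub h : derived_subgroup M h -> M h.
Proof. by apply=> // z [a [b [Ma Mb ->]]]; apply: subgroup_gcomm. Qed.

(* If [h g^r = g^r h s] with [s] commuting with [g] and [h], then the [h s^i] are
   conjugates of [h], so finitely many roots of its minimal polynomial. *)
Lemma derived_ucs_gcomm_torsion s n h g : (forall x, x \in s -> M x) ->
  derived_subgroup M h -> ucs (gens s) n h -> gens s g -> torsion (gcomm h g).
Proof.
move=> sSM; have [sG GM _] := gensP maxM nilM sSM; set G := gens s in sG GM *.
elim: n h g => [|n IH] h g dh Zh Gg.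
  exists 1%N; rewrite // expr1 Zh; apply/gcomm1P; rewrite ?unitr1 ?mulr1 ?mul1r //.
  exact/UM/GM.
have Mh := derived_sub dh; have Mg := GM _ Gg.
have [Uh Ug] := (UM Mh, UM Mg).
have [Gh Zv] := Zh; set v := gcomm h g.
have dv : derived_subgroup M v by apply: gen_sub; exists h, g.
have Mv := derived_sub dv; have Uv := UM Mv.
have tC x : G x -> torsion (gcomm v x) /\ in_center (gcomm v x).
  move=> Gx; have t := IH v x dv (Zv g Gg) Gx; split=> //.
  by apply: torsion_in_center t; apply: subgroup_gcomm => //; apply: GM.
have [[a a0 ea] Ze] := tC g Gg; have [[b b0 fb] Zf] := tC h Gh.
set e := gcomm v g in ea Ze; set f := gcomm v h in fb Zf.
(* [r] kills both [[v, g]] and [[v, h]], so [v ^+ r] commutes with [g] and [h]. *)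
pose r := (a * b)%N; have r0 : (0 < r)%N by rewrite muln_gt0 a0.
have er : e ^+ r = 1 by rewrite exprM ea expr1n.
have fr : f ^+ r = 1 by rewrite /r mulnC exprM fb expr1n.
have vrh : v ^+ r * h = h * v ^+ r.
  by rewrite (expr_mulr_gcomm r (mulr_gcomm Uv Uh) (esym (Zf v))) fr mulr1.
have vrg : v ^+ r * g = g * v ^+ r.
  by rewrite (expr_mulr_gcomm r (mulr_gcomm Uv Ug) (esym (Ze v))) er mulr1.
have hg := mulr_expr_gcomm r (mulr_gcomm Uh Ug) (mulr_gcomm Uv Ug) (Ze g) (Ze v).
rewrite -/v -/e in hg; set E := e ^+ 'C(r, 2) in hg.
have ZE : in_center E by apply: in_centerX.
have tE : torsion E by exists a; rewrite // /E exprAC ea expr1n.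
pose t := v ^+ r * E; have th : t * h = h * t by rewrite /t -mulrA ZE mulrA vrh mulrA.
have tg : t * g ^+ r = g ^+ r * t.
  by rewrite /t -mulrA ZE mulrA (commrX_eq r vrg) mulrA.
have hg1 : h * g ^+ r = g ^+ r * h * t by rewrite hg mulrA.
have hX (i : nat) : h * (g ^+ r) ^+ i = (g ^+ r) ^+ i * (h * t ^+ i).
  have := mulr_expr_gcomm i hg1 (c := 1).
  by rewrite !mulr1 !mul1r expr1n mulr1 mulrA; apply.
have htC (i j : nat) : h * t ^+ i * (h * t ^+ j) = h * t ^+ j * (h * t ^+ i).
  have thX k : t ^+ k * h = h * t ^+ k by rewrite (commrX_eq k (esym th)).
  by rewrite !mulrA -(mulrA h) thX -(mulrA h (t ^+ j)) thX -!mulrA -!exprD addnC.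
have [k k0 hk] := algebraic_conj_comm divD (algM dh) (unitrX r Ug) hX htC.
have Et : t ^+ k = 1.
  apply: (mulrI Uh); apply: (mulrI (unitrX k (unitrX r Ug))).
  by rewrite -hX hk mulr1.
have tt : torsion t by exists k.
have UE : E \is a GRing.unit by rewrite unitrX //; exact: UM (subgroup_gcomm sM Mv Mg).
have [l l0 vl] : torsion (v ^+ r).
  rewrite -[v ^+ r](mulrK UE); apply: torsionM tt (torsionV tE).
  exact: esym (in_centerV ZE _).
by exists (r * l)%N; [rewrite muln_gt0 r0 | rewrite exprM].
Qed.

Lemma derived_in_center h : derived_subgroup M h -> in_center h.
Proof.
move=> dh; have Mh := derived_sub dh.
apply: (semicentral_in_center noSC) => // m Mm.
have sSM x : x \in [:: h; m] -> M x by rewrite !inE => /orP[] /eqP->.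
have [sG GM [n Gn]] := gensP maxM nilM sSM.
apply: torsion_in_center; first exact: subgroup_gcomm.
apply: (derived_ucs_gcomm_torsion sSM dh (n := n)).
  by apply: Gn; apply: gen_sub; rewrite inE eqxx.
by apply: gen_sub; rewrite !inE eqxx orbT.
Qed.

Lemma maxM_in_center x : M x -> in_center x.
Proof.
move=> Mx; apply: (semicentral_in_center noSC) => // m Mm.
by apply: derived_in_center; apply: gen_sub; exists x, m.
Qed.

End DerivedSubgroup.

Theorem theorem2p10 (D : unitRingType) (M : D -> Prop) :
  is_division_ring D ->
  (exists x y : D, x * y != y * x) ->
  maximal_subgroup M ->
  locally_nilpotent M ->
  set_algebraic_over_center (derived_subgroup M) ->
  exists K : D -> Prop, maximal_subfield K /\ (forall x, M x <-> (K x /\ x != 0)).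
Proof.
move=> divD ncD maxM nilM algM.
case: (classic (exists h, [/\ M h, ~ in_center h & forall m, M m -> h * m = m * h])).
  by case=> h [Mh nZh hM]; apply: (central_maxM_subfield divD maxM nilM Mh nZh hM).
move=> nE; have [h [Mh []]] := maxM_not_central divD maxM ncD.
apply: (maxM_in_center divD maxM nilM _ algM Mh) => k.
apply: (no_semicentral divD maxM nilM algM) => g Mg gM.
by apply: NNPP => nZ; apply: nE; exists g.
Qed.
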